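(* Let $X$ be an $L^1$-predual space such that $\operatorname{ex}B_{X^*}/{\sim}$ does not contain an isolated point. Then every operator $T\in L(X)$ which is weakly compact or factors through a closed subspace of $c_0$ satisfies $\|\mathrm{Id}+T\|=1+\|T\|$.
   Context: $X$ (real or complex) is an $L^1$-predual space if $X^*$ is isometric to a space $L^1(\mu)$. $\operatorname{ex}B_{X^*}$ is the set of extreme points of the closed unit ball of $X^*$, with the weak$^*$ topology; $p\sim q$ means $p,q\in\operatorname{ex}B_{X^*}$ are linearly dependent, and $\operatorname{ex}B_{X^*}/{\sim}$ carries the quotient topology. $T$ factors through a subspace of $c_0$ if $T=T_2T_1$ with bounded $T_1\colon X\to E$, $T_2\colon E\to X$, $E\subset c_0$ closed. *)

(* Defs.v *)
From HB Require Import structures.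
From mathcomp Require Import all_boot all_order all_algebra.
From mathcomp Require Import all_classical all_reals all_analysis.
From mathcomp Require Export complex.
Export numFieldNormedType.Exports.
Import Order.TTheory GRing.Theory Num.Theory.
Set Implicit Arguments. Unset Strict Implicit. Unset Printing Implicit Defensive.
Local Open Scope classical_set_scope.
Local Open Scope ring_scope.

(* Scalars: K (later instantiated with R or R[i] for R : realType).
   Elements of X^* are represented as functions X -> K that are linear and
   bounded. *)
Section BanachDefs.
Context {K : numFieldType} {X : normedModType K}.

Definition is_linear_functional (f : X -> K) : Prop :=
  forall (a : K) (x y : X), f (a *: x + y) = a * f x + f y.

Definition is_bounded_functional (f : X -> K) : Prop :=
  exists C : K, forall x : X, `|f x| <= C * `|x|.

Definition dual_elt (f : X -> K) : Prop :=
  is_linear_functional f /\ is_bounded_functional f.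

Definition is_operator (T : X -> X) : Prop :=
  (forall (a : K) (x y : X), T (a *: x + y) = a *: T x + T y) /\
  (exists C : K, forall x : X, `|T x| <= C * `|x|).

(* c = sup { N x : ||x|| <= 1 }  (least upper bound in K);
   with N x = ||T x|| this says  ||T|| = c. *)
Definition is_norm_sup (N : X -> K) (c : K) : Prop :=
  (forall x : X, `|x| <= 1 -> N x <= c) /\
  (forall d : K, (forall x : X, `|x| <= 1 -> N x <= d) -> c <= d).

Definition dual_ball (f : X -> K) : Prop :=
  dual_elt f /\ forall x : X, `|x| <= 1 -> `|f x| <= 1.

Definition dual_ext (f : X -> K) : Prop :=
  dual_ball f /\
  forall (g h : X -> K) (t : K), dual_ball g -> dual_ball h -> 0 < t < 1 ->
    (forall x, f x = t * g x + (1 - t) * h x) -> forall x, g x = h x.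

Definition lin_dep (p q : X -> K) : Prop :=
  exists a b : K, (a != 0 \/ b != 0) /\ forall x, a * p x + b * q x = 0.

Definition weakstar_rel_open (S A : set (X -> K)) : Prop :=
  A `<=` S /\
  forall p, A p -> exists (n : nat) (xs : nat -> X) (e : K), 0 < e /\
    forall q, S q -> (forall i, (i < n)%N -> `|q (xs i) - p (xs i)| < e) -> A q.

(* ex B_{X^*}/~ (quotient topology) has no isolated point: for every class
   [p], the singleton {[p]} is not open in the quotient, i.e. its preimage
   {q in ex B_{X^*} | q ~ p} is not relatively weak*-open in ex B_{X^*}. *)
Definition no_isolated_point_quotient : Prop :=
  forall p, dual_ext p ->
    ~ weakstar_rel_open dual_ext [set q | dual_ext q /\ lin_dep p q].

Definition weak_open (U : set X) : Prop :=
  forall x, U x -> exists (n : nat) (fs : nat -> X -> K) (e : K), 0 < e /\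
    (forall i, (i < n)%N -> dual_elt (fs i)) /\
    forall y, (forall i, (i < n)%N -> `|fs i y - fs i x| < e) -> U y.

Definition weak_closure (A : set X) : set X :=
  [set x | forall U, weak_open U -> U x -> exists y, A y /\ U y].

Definition weak_compact (C : set X) : Prop :=
  forall F : set (set X), (forall U, F U -> weak_open U) ->
    (forall x, C x -> exists U, F U /\ U x) ->
    exists (n : nat) (G : nat -> set X), (forall i, (i < n)%N -> F (G i)) /\
      forall x, C x -> exists i, (i < n)%N /\ G i x.

Definition weakly_compact_op (T : X -> X) : Prop :=
  weak_compact (weak_closure [set T x | x in [set x : X | `|x| <= 1]]).

Definition c0 : set (nat -> K) :=
  [set s | forall e : K, 0 < e -> exists N : nat, forall n, (N <= n)%N -> `|s n| < e].

Definition closed_subspace_c0 (E : set (nat -> K)) : Prop :=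
  E `<=` c0 /\ E (fun _ => 0) /\
  (forall (a : K) s t, E s -> E t -> E (fun n => a * s n + t n)) /\
  (forall s : nat -> K,
     (forall e : K, 0 < e -> exists t, E t /\ forall n, `|s n - t n| <= e) -> E s).

Definition factors_through_c0_subspace (T : X -> X) : Prop :=
  exists (E : set (nat -> K)) (T1 : X -> nat -> K) (T2 : (nat -> K) -> X),
    closed_subspace_c0 E /\
    (forall x, E (T1 x)) /\
    (forall (a : K) x y, T1 (a *: x + y) = (fun n => a * T1 x n + T1 y n)) /\
    (exists C : K, forall x n, `|T1 x n| <= C * `|x|) /\
    (forall (a : K) s t, E s -> E t ->
       T2 (fun n => a * s n + t n) = a *: T2 s + T2 t) /\
    (exists C : K, forall s (B : K), E s -> (forall n, `|s n| <= B) -> `|T2 s| <= C * B) /\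
    (forall x, T x = T2 (T1 x)).

(* X is an L^1-predual: X^* is isometrically isomorphic to L^1(mu).
   K-valued functions are handled through their real and imaginary parts
   re, im : K -> R; elements of L^1(mu) are a.e.-classes. *)
Definition modK {R : realType} (re im : K -> R) (z : K) : R :=
  Num.sqrt (re z ^+ 2 + im z ^+ 2).

Definition L1_predual {R : realType} (re im : K -> R) : Prop :=
  exists (d : measure_display) (Om : measurableType d)
         (mu : {measure set Om -> \bar R}) (Phi : (X -> K) -> Om -> K),
    (forall f, dual_elt f ->
       measurable_fun setT (fun w => re (Phi f w)) /\
       measurable_fun setT (fun w => im (Phi f w))) /\
    (forall (a : K) f g, dual_elt f -> dual_elt g ->
       {ae mu, forall w, Phi (fun x => a * f x + g x) w = a * Phi f w + Phi g w}) /\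
    (forall f (c : K), dual_elt f -> is_norm_sup (fun x => `|f x|) c ->
       (\int[mu]_w (modK re im (Phi f w))%:E = (re c)%:E)%E) /\
    (forall g : Om -> K,
       measurable_fun setT (fun w => re (g w)) ->
       measurable_fun setT (fun w => im (g w)) ->
       (\int[mu]_w (modK re im (g w))%:E < +oo)%E ->
       exists f, dual_elt f /\ {ae mu, forall w, Phi f w = g w}).

End BanachDefs.

(* Main.v *)
Require Import Defs.
From HB Require Import structures.
From mathcomp Require Import all_boot all_order all_algebra.
From mathcomp Require Import all_classical all_reals all_analysis.
From mathcomp Require Import complex.
From mathcomp Require Import measurable_realfun ring lra.
Import numFieldNormedType.Exports.
Import Order.TTheory GRing.Theory Num.Theory.
Set Implicit Arguments. Unset Strict Implicit. Unset Printing Implicit Defensive.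
Local Open Scope classical_set_scope.
Local Open Scope ring_scope.

(* In X^* = L^1(mu) an extreme point p of the ball is carried by an atom of mu, so its span is
   an L-summand: every functional f has a coefficient phi_p(f) at p with
   |f| = |phi_p(f)| + |f - phi_p(f) p|, and the coefficients of f at pairwise inequivalent
   extreme points sum up to at most |f|.  Hence |p + T^*p| = |1 + l| + |T^*p| - |l| with
   l = phi_p(T^*p), and it suffices to find, in every weak*-slice of the ball, an extreme
   point p at which |l| is small.

   If T is weakly compact, T^** maps the functional phi_p into X, so q |-> phi_p(T^*q) is
   weak*-continuous.  If |l| > e throughout a slice, one picks inductively inequivalent
   extreme points p_1, p_2, ... there such that T^*p_n has coefficients of modulus > e/2 at
   p_1, ..., p_(n-1); this contradicts the summation bound.

   If T = T_2 T_1 factors through a subspace of c_0, then T^*q lies in the closed span of the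
   countably many functionals f_n = e_n o T_1, so phi_q(T^*q) = 0 as soon as all phi_q(f_n)
   vanish.  The sets {q : |phi_q(f_n)| >= 1/k} meet only finitely many classes, hence are
   nowhere dense, and the extreme points form a Baire space by Choquet's theorem. *)

(** The extreme points need not form a closed or locally compact set, so a Baire argument cannot
    shrink closed neighbourhoods to a point. It runs on complements: every neighbourhood of an
    extreme point contains the complement, in the ball, of a relatively open convex set whose
    closure misses that point. An increasing union of such sets is again open and convex, it stays
    proper by compactness, and a proper relatively open convex set always misses an extreme point.

    Both cases exhaust the same bound: at most |f|/d pairwise inequivalent extreme points carry
    coefficients of f of modulus at least d. The absence of isolated points enters only by allowing
    any open set that meets the extreme points to be shrunk off a given class and still meet them.

    The vanishing of phi_q(T^*q) in the c_0 case is proved by a gliding hump, which avoids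
    describing the dual of E: only the decay of the sequences in E enters. *)

(** * Functions with the topology of pointwise convergence *)

Section Pointwise.
Context {R : realType} {Y : choiceType}.
Local Notation E := {ptws Y -> R}.

Lemma ptws_cvgP (F : set_system E) (f : E) : Filter F ->
  (F --> f) <-> (forall y, (fun g : E => g y) @ F --> f y).
Proof.
move=> FF; split=> [Ff y|Ff].
  exact: cvg_comp Ff (@proj_continuous Y (fun=> R) y f).
apply/cvg_sup => y U [V [[W oW <-] Wf] WU].
apply: filterS WU _; apply: Ff; exact: open_nbhs_nbhs.
Qed.

Lemma ptws_cvg_map (I : Type) (F : set_system I) (h : I -> E) (f : E) :
  Filter F -> (forall y, (fun i => h i y) @ F --> f y) -> h @ F --> f.
Proof. by move=> FF hf; apply/ptws_cvgP => y U /hf. Qed.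

Lemma ptws_eval_continuous (y : Y) : continuous (fun g : E => g y).
Proof. exact: (@proj_continuous Y (fun=> R) y). Qed.

Lemma ptws_eval_closed (y : Y) (D : set R) : closed D -> closed [set f : E | D (f y)].
Proof. by have /continuous_closedP := @ptws_eval_continuous y; apply. Qed.

Lemma ptws_eval_open (y : Y) (D : set R) : open D -> open [set f : E | D (f y)].
Proof. by have /continuousP := @ptws_eval_continuous y; apply. Qed.

Lemma ptws_hausdorff : hausdorff_space E.
Proof. by apply: (@hausdorff_product Y (fun=> R)) => _; exact: Rhausdorff. Qed.

Definition basic_nbhs (f : E) (s : seq Y) (e : R) : set E :=
  [set g | forall y, y \in s -> `|g y - f y| < e].

(** The basic sets generate a filter that converges to [f] in every coordinate, hence in the product
    topology, so this filter contains every neighbourhood of [f]. *)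
Lemma nbhs_basicP (f : E) (V : set E) : nbhs f V ->
  exists s e, 0 < e /\ basic_nbhs f s e `<=` V.
Proof.
pose B := [set se : seq Y * R | 0 < se.2].
pose F := filter_from B (fun se => basic_nbhs f se.1 se.2).
have FF : Filter F.
  apply: filter_from_filter; first by exists ([::], 1); rewrite /B/=.
  move=> [s e] [s' e']; rewrite /B/= => e0 e'0.
  exists (s ++ s', Num.min e e'); rewrite /= ?lt_min ?e0 ?e'0//.
  move=> g; rewrite /basic_nbhs /= => gf; split=> y ys.
    by have := gf y; rewrite mem_cat ys lt_min => /(_ isT)/andP[].
  by have := gf y; rewrite mem_cat ys orbT lt_min => /(_ isT)/andP[].
have : F --> f.
  apply/ptws_cvgP => y; apply/cvgrPdist_lt => e e0.
  exists ([:: y], e) => //= g; rewrite /basic_nbhs /= => /(_ y).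
  by rewrite inE eqxx distrC; apply.
by move=> /(_ V) + nV => /(_ nV)[[s e] /= e0 sV]; exists s, e.
Qed.

Lemma basic_nbhs_open f s e : open (basic_nbhs f s e).
Proof.
elim: s => [|y s IHs].
  rewrite (_ : basic_nbhs _ _ _ = setT); first exact: openT.
  by apply/seteqP; split=> g //= _ y.
rewrite (_ : basic_nbhs _ _ _ =
  [set g | `|g y - f y| < e] `&` basic_nbhs f s e).
  apply: openI => //.
  apply: (@open_comp _ _ (fun g : E => g y) [set r | `|r - f y| < e]).
    by move=> g _; exact: ptws_eval_continuous.
  rewrite (_ : [set _ | _] = ball (f y) e); first exact: ball_open.
  by apply/seteqP; split=> r; rewrite /ball/= distrC.
apply/seteqP; split=> g; rewrite /basic_nbhs /=.
  move=> H; split=> [|z zs]; apply: H; rewrite inE ?eqxx// zs orbT//.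
by move=> [gy gs] z; rewrite inE => /orP[/eqP->//|]; exact: gs.
Qed.

Definition mix (t : R) (f g : E) : E := fun y => t * f y + (1 - t) * g y.

Lemma cvg_mix (I : Type) (F : set_system I) (t : I -> R) (f g : I -> E) t0 f0 g0 :
  Filter F -> t @ F --> t0 -> f @ F --> f0 -> g @ F --> g0 ->
  (fun i => mix (t i) (f i) (g i)) @ F --> mix t0 f0 g0.
Proof.
move=> FF ct cf cg; apply: ptws_cvg_map => y.
have cfy : (fun i => f i y) @ F --> f0 y := cvg_comp _ _ cf (@ptws_eval_continuous y f0).
have cgy : (fun i => g i y) @ F --> g0 y := cvg_comp _ _ cg (@ptws_eval_continuous y g0).
apply: (@cvgD _ R^o); apply: cvgM => //.
by apply: (@cvgB _ R^o) => //; exact: cvg_cst.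
Qed.

Definition mix_convex (A : set E) :=
  forall f g t, A f -> A g -> 0 <= t <= 1 -> A (mix t f g).

Definition mix_extreme (C : set E) (f : E) := C f /\
  forall g h t, C g -> C h -> 0 < t < 1 -> f = mix t g h -> g = h.

Lemma mix0 f g : mix 0 f g = g.
Proof. by apply/funext => y; rewrite /mix mul0r add0r subr0 mul1r. Qed.
Lemma mix1 f g : mix 1 f g = f.
Proof. by apply/funext => y; rewrite /mix mul1r subrr mul0r addr0. Qed.
Lemma mixff t f : mix t f f = f.
Proof. by apply/funext => y; rewrite /mix -mulrDl subrKC mul1r. Qed.
Lemma mixC t f g : mix t f g = mix (1 - t) g f.
Proof. by apply/funext => y; rewrite /mix subKr addrC. Qed.

Lemma mix_mixl s t f g h : mix t (mix s f g) h = mix s (mix t f h) (mix t g h).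
Proof. by apply/funext => y; rewrite /mix; ring. Qed.

Lemma mix_pre_open t h (M : set E) : open M -> open [set f | M (mix t f h)].
Proof.
move=> oM; apply: (@open_comp _ _ (fun f => mix t f h)) => // f _.
exact: (@cvg_mix E (nbhs f) (fun=> t) id (fun=> h) t f h _
  (cvg_cst _) cvg_id (cvg_cst _)).
Qed.

End Pointwise.

(** * Extreme points of compact convex sets, after Choquet *)

Section Extreme.
Context {R : realType} {Y : choiceType}.
Local Notation E := {ptws Y -> R}.
Variable C : set E.
Hypotheses (cC : compact C) (vC : mix_convex C).

(** At weight 0 every mixture is [x] itself; compactness of [C] makes the admissible weight uniform
    in [f]. *)
Lemma compact_mix_absorb (M : set E) (x : E) : open M -> M x ->
  exists2 d : R, 0 < d & forall t, 0 <= t <= d -> forall f, C f -> M (mix t f x).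
Proof.
move=> oM Mx.
have /compact_near_coveringP/(_ R (nbhs (0 : R)) (fun t f => M (mix t f x))) := cC.
case.
  move=> f Cf.
  have cm : (fun p : E * R => mix p.2 p.1 x) @ filter_prod (nbhs f) (nbhs (0 : R))
      --> mix 0 f x.
    by apply: cvg_mix; [exact: cvg_snd|exact: cvg_fst|exact: cvg_cst].
  by apply: cm; rewrite mix0; exact: open_nbhs_nbhs.
move=> d /= d0 dM; exists (d / 2); first by rewrite divr_gt0.
move=> t /andP[t0 td] f Cf; apply: dM => //=.
by rewrite sub0r normrN ger0_norm//; apply: le_lt_trans td _; lra.
Qed.

(* The complement of a maximal proper relatively open convex subset is a single
   extreme point. *)
Section Maximal.
Variable M : set E.
Hypotheses (oM : open M) (vM : mix_convex (C `&` M)) (pM : exists2 f, C f & ~ M f).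
Hypothesis maxM : forall W, open W -> mix_convex (C `&` W) -> C `&` M `<=` W ->
  C `<=` W \/ C `&` W `<=` M.

Let pre_convex t h : C h -> 0 <= t <= 1 ->
  mix_convex (C `&` [set f | M (mix t f h)]).
Proof.
move=> Ch t01 f g s [Cf Mf] [Cg Mg] s01; split; first exact: vC.
by rewrite /= mix_mixl; apply: (vM _ _ s01).2; split => //; apply: vC.
Qed.

(** The preimage of [M] under the contraction [mix t _ x] competes with [M] in [maxM]. If it covers
    [C], the claim holds. If it lies in [M], then [M] can be pulled back along all powers of the
    contraction; a high power maps all of [C] into [M], so [C] would lie in [M]. *)
Let mix_in x f t : C x -> M x -> C f -> 0 < t < 1 -> M (mix t f x).
Proof.
move=> Cx Mx Cf /andP[t0 t1].
have t01 : 0 <= t <= 1 by rewrite !ltW.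
have [d d0 dM] := compact_mix_absorb oM Mx.
case: (maxM (mix_pre_open t x oM) (pre_convex Cx t01)) => [g [Cg Mg]|sub|sub].
- exact: (vM (conj Cg Mg) (conj Cx Mx) t01).2.
- exact: sub.
have iterM n g : C g -> M (mix (t ^+ n) g x) -> M g.
  elim: n g => [|n IHn] g Cg; first by rewrite expr0 mix1.
  have tn01 : 0 <= t ^+ n <= 1 by rewrite exprn_ge0 ?exprn_ile1// ltW.
  rewrite exprS (_ : mix _ g x = mix t (mix (t ^+ n) g x) x); last first.
    by apply/funext => y; rewrite /mix; ring.
  by move=> H; apply: IHn => //; apply: sub; split => //; exact: vC.
have [h Ch nMh] := pM; exfalso; apply: nMh.
have /cvgrPdist_lt/(_ d d0)[n _ /(_ n (leqnn n))] : (fun n => t ^+ n) @ \oo --> (0 : R).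
  by apply: cvg_expr; rewrite ger0_norm // ltW.
rewrite /= sub0r normrN ger0_norm ?exprn_ge0 ?ltW// => tnd.
by apply: (iterM n) => //; apply: dM => //; rewrite exprn_ge0 ltW.
Qed.

(** If [f] and [g] differ at [y], the strip [V] around [f y] of radius [|g y - f y|] is open,
    convex, contains [f] and misses [g]. By [mix_in] the union of [M] and [V] is still convex in
    [C], against maximality. *)
Let compl_eq f g : C f -> C g -> ~ M f -> ~ M g -> f = g.
Proof.
move=> Cf Cg nMf nMg; apply: contrapT => fg.
have [y fgy] : exists y, f y <> g y by apply/existsNP => H; apply: fg; exact/funext.
pose V := basic_nbhs f [:: y] `|g y - f y|.
have VP h : V h <-> `|h y - f y| < `|g y - f y|.
  rewrite /V /basic_nbhs /=; split; first by apply; rewrite inE.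
  by move=> H z; rewrite inE => /eqP->.
have vV h k t : V h -> V k -> 0 <= t <= 1 -> V (mix t h k).
  move=> /VP Vh /VP Vk /andP[t0 t1]; apply/VP.
  rewrite (_ : mix t h k y - f y = t * (h y - f y) + (1 - t) * (k y - f y));
    last by rewrite /mix; ring.
  apply: le_lt_trans (ler_normD _ _) _; rewrite !normrM (ger0_norm t0) (@ger0_norm _ (1 - t)); last lra.
  have [->|tn0] := eqVneq t 0; first by rewrite mul0r add0r subr0 mul1r.
  have tp : 0 < t by rewrite lt_neqAle eq_sym tn0.
  have := ltr_pM2l tp `|h y - f y| `|g y - f y|; rewrite Vh => H1.
  have : (1 - t) * `|k y - f y| <= (1 - t) * `|g y - f y|.
    by apply: ler_wpM2l; [lra|exact: ltW].
  by lra.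
have oW : open (M `|` V) by apply: openU => //; exact: basic_nbhs_open.
have Vf : V f by apply/VP; rewrite subrr normr0 normr_gt0 subr_eq0; apply/eqP => /esym.
have nVg : ~ V g by move=> /VP; rewrite ltxx.
case: (maxM oW) => [|h [Ch Mh]||].
- move=> h k t [Ch Wh] [Ck Wk] t01; split; first exact: vC.
  have [->|tn0] := eqVneq t 0; first by rewrite mix0.
  have [->|tn1] := eqVneq t 1; first by rewrite mix1.
  have t01' : 0 < t < 1 by rewrite !lt_neqAle eq_sym tn0 tn1.
  case: Wh Wk => [Mh|Vh] [Mk|Vk]; [left|left|left|right].
  + by apply: (vM _ _ t01).2.
  + by rewrite mixC; apply: mix_in => //; lra.
  + exact: mix_in.
  + exact: vV.
- by left.
- by move=> /(_ g Cg)[].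
- by move=> /(_ f (conj Cf (or_intror Vf))).
Qed.

(** By [compl_eq] the point [e] is alone outside [M]. The ends of a nontrivial segment through [e]
    differ from [e], hence lie in the convex set [M], which would then contain [e]. *)
Lemma maximal_open_convex_extreme : exists2 e, mix_extreme C e & ~ M e.
Proof.
have [e Ce nMe] := pM; exists e => //; split => // g h t Cg Ch t01 egh.
apply: contrapT => gh.
have t01' : 0 <= t <= 1 by case/andP: t01 => ? ?; rewrite !ltW.
have in_M k : C k -> k <> e -> M k.
  by move=> Ck ke; apply: contrapT => nMk; apply: ke; exact: compl_eq.
have ne k k' s : C k -> C k' -> 0 < s < 1 -> e = mix s k k' -> k <> k' -> k' <> e.
  move=> Ck Ck' /andP[s0 s1] ekk' kk' k'e; apply: kk'.
  apply/funext => y; move: (congr1 (@^~ y) ekk') (congr1 (@^~ y) k'e) => /=.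
  rewrite /mix => -> k'y.
  have : s * (k y - k' y) = 0 by lra.
  by move/eqP; rewrite mulf_eq0 gt_eqF//= subr_eq0 => /eqP.
apply: nMe; rewrite egh.
have Mh : M h by apply: in_M => //; exact: ne egh gh.
have Mg : M g.
  apply: in_M => //; apply: (ne h g (1 - t)) => //; [lra|by rewrite -mixC|exact/nesym].
exact: (vM (conj Cg Mg) (conj Ch Mh) t01').2.
Qed.

End Maximal.

(** Zorn's lemma enlarges [U] to a maximal proper relatively open convex set, to which the previous
    lemma applies. *)
Lemma open_convex_misses_extreme (U : set E) : open U -> mix_convex (C `&` U) ->
  (exists2 f, C f & ~ U f) -> exists2 e, mix_extreme C e & ~ U e.
Proof.
move=> oU vU [f0 Cf0 nUf0].
(* The conditions bear on the union of [V] with [U], so that the empty chain, whose union is empty,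
   also satisfies them. *)
pose P := [set V : set E | [/\ open (V `|` U), mix_convex (C `&` (V `|` U)) &
  exists2 f, C f & ~ (V `|` U) f]].
have [] := @Zorn_bigcup E P.
  move=> F FP totF; split.
  - rewrite (_ : _ `|` U = (\bigcup_(V in F) (V `|` U)) `|` U).
      by apply: openU => //; apply: bigcup_open => V /FP[].
    apply/seteqP; split=> f [[V FV Vf]|Uf]; [|by right| |by right].
      by left; exists V => //; left.
    by case: Vf => [Vf|Uf]; [left; exists V|right].
  - have key f g t V : F V -> C f -> C g -> (V `|` U) f -> (V `|` U) g ->
        0 <= t <= 1 -> (\bigcup_(X in F) X `|` U) (mix t f g).
      move=> FV Cf Cg Vf Vg t01; have [_ vV _] := FP _ FV.
      have [_ [Vm|Um]] := vV _ _ _ (conj Cf Vf) (conj Cg Vg) t01; last by right.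
      by left; exists V.
    move=> f g t [Cf Wf] [Cg Wg] t01; split; first exact: vC.
    case: Wf Wg => [[V FV Vf]|Uf] [[W FW Wg]|Ug].
    + have [VW|WV] := totF _ _ FV FW.
        by apply: (key _ _ _ W) => //; left => //; exact: VW.
      by apply: (key _ _ _ V) => //; left => //; exact: WV.
    + by apply: (key _ _ _ V) => //; [left|right].
    + by apply: (key _ _ _ W) => //; [right|left].
    + by right; apply: (vU _ _ _ (conj Cf Uf) (conj Cg Ug) t01).2.
  - have [[V0 FV0]|F0] := pselect (exists V, F V); last first.
      by exists f0 => // -[[V FV _]|//]; apply: F0; exists V.
    apply: contrapT => H.
    have covC f : C f -> (\bigcup_(X in F) X `|` U) f.
      by move=> Cf; apply: contrapT => nf; apply: H; exists f.
    (* The tails of the chain form a filter; if the union covered [C], compactness along this filter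
       would yield one member covering [C]. *)
    pose G := filter_from F (fun V => [set W | F W /\ V `<=` W]).
    have FG : Filter G.
      apply: filter_from_filter; first by exists V0.
      move=> V W FV FW; have [VW|WV] := totF _ _ FV FW.
        by exists W => // X [FX WX]; do 2?split => //; exact: subset_trans VW WX.
      by exists V => // X [FX VX]; do 2?split => //; exact: subset_trans WV VX.
    have /compact_near_coveringP/(_ (set E) G (fun V f => (V `|` U) f)) := cC.
    case.
      move=> f Cf.
      have [V [FV Vf]] : exists V, F V /\ (V `|` U) f.
        by case: (covC _ Cf) => [[V FV Vf]|Uf]; [exists V|exists V0]; split => //; [left|right].
      exists ((V `|` U), [set W | F W /\ V `<=` W]).
        split; last by exists V.
        by apply: open_nbhs_nbhs; split => //; have [] := FP _ FV.
      by move=> [g W] /= [[Vg|Ug] [FW VW]]; [left; exact: VW|right].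
    move=> V FV /(_ V)/(_ (conj FV (@subset_refl _ _))) CV.
    by have [_ _ [f Cf nf]] := FP _ FV; apply: nf; exact: CV.
move=> V [[oM vM pM] maxV].
have [e ee nMe] : exists2 e, mix_extreme C e & ~ (V `|` U) e.
  apply: maximal_open_convex_extreme => // W oW vW MW.
  have [CW|nCW] := pselect (C `<=` W); [by left|right].
  apply: contrapT => /existsNP[g /not_implyP[[Cg Wg] nMg]].
  (* [W] contains the maximal set only inside [C], so the competitor for Zorn is their union, which
     agrees with [W] on [C]. *)
  have CWE : C `&` ((W `|` (V `|` U)) `|` U) = C `&` W.
    apply/seteqP; split=> f [Cf]; last by move=> Wf; split => //; left; left.
    by move=> [[Wf|Mf]|Uf]; split => //; apply: MW; split => //; right.
  apply: (maxV (W `|` (V `|` U))).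
    split; first by move=> f Vf; right; left.
    by move=> /(_ g (or_introl Wg)) Vg; apply: nMg; left.
  split.
  - rewrite (_ : _ `|` U = W `|` (V `|` U)); first exact: openU.
    by rewrite -!setUA setUid.
  - by rewrite CWE.
  - have /existsNP[f /not_implyP[Cf nWf]] := nCW; exists f => // Hf.
    have : (C `&` W) f by rewrite -CWE.
    by case.
by exists e => // Ue; apply: nMe; right.
Qed.

(** [D] is the convex hull of the union of [A] and [B]. As a continuous image of a compact product
    it is compact without taking a closure, so each of its points is an explicit mixture, and an
    extreme point among them must already lie in [A] or [B]. *)
Lemma compact_convex_join (q : E) (A B : set E) : mix_extreme C q ->
  A `<=` C -> B `<=` C -> compact A -> compact B -> mix_convex A -> mix_convex B ->
  ~ A q -> ~ B q ->
  exists D : set E, [/\ D `<=` C, compact D, mix_convex D, ~ D q & A `|` B `<=` D].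
Proof.
move=> [Cq exq] AC BC cA cB vA vB nAq nBq.
have [A0|/set0P[a0 Aa0]] := eqVneq A set0.
  by exists B; split => //; rewrite A0 set0U.
have [B0|/set0P[b0 Bb0]] := eqVneq B set0.
  by exists A; split => //; rewrite B0 setU0.
pose m (p : R * E * E) := mix p.1.1 p.1.2 p.2.
pose S := (`[0, 1]%classic `*` A) `*` B : set (R * E * E).
exists (m @` S); split.
- move=> _ [[[t a] b] /= [[+ Aa] Bb] <-]; rewrite /= in_itv/= => t01.
  by apply: vC => //; [exact: AC|exact: BC].
- apply: continuous_compact; last first.
    by apply: compact_setX => //; apply: compact_setX => //; exact: segment_compact.
  apply: continuous_subspaceT => p.
  apply: (@cvg_mix R Y (R * E * E) (nbhs p) (fun p => p.1.1) (fun p => p.1.2) snd).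
  + by apply: (@cvg_comp _ _ _ fst fst _ (nbhs p.1)); exact: cvg_fst.
  + by apply: (@cvg_comp _ _ _ fst snd _ (nbhs p.1)); [exact: cvg_fst|exact: cvg_snd].
  + exact: cvg_snd.
(* In a mixture of two points of [D], the weights falling on [A] (and likewise on [B]) are
   renormalised to [r] and [1 - r]; if both vanish, any [r] serves. *)
- have weight (x y : R) : 0 <= x -> 0 <= y ->
      exists r, [/\ 0 <= r <= 1, r * (x + y) = x & (1 - r) * (x + y) = y].
    move=> x0 y0; have [xy0|xy0] := eqVneq (x + y) 0.
      by exists 0; split; rewrite ?lexx ?ler01//; lra.
    have xyp : 0 < x + y by rewrite lt_neqAle eq_sym xy0 addr_ge0.
    exists (x / (x + y)); split.
    + by rewrite divr_ge0 ?addr_ge0//= ler_pdivrMr// mul1r lerDl.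
    + by rewrite divfK.
    + by rewrite mulrBl divfK// mul1r addrC addKr.
  move=> _ _ s [[[t a] b] /= [[+ Aa] Bb] <-] [[[t' a'] b'] /= [[+ Aa'] Bb'] <-].
  rewrite /= !in_itv/= => t01 t'01 s01.
  have [r [r01 r1 r2]] := weight (s * t) ((1 - s) * t') ltac:(nra) ltac:(nra).
  have [u [u01 u1 u2]] :=
    weight (s * (1 - t)) ((1 - s) * (1 - t')) ltac:(nra) ltac:(nra).
  exists (s * t + (1 - s) * t', mix r a a', mix u b b').
    by rewrite /S/= in_itv/=; split; [split|]; [nra|exact: vA|exact: vB].
  apply/funext => y; rewrite /m /mix /=.
  transitivity (r * (s * t + (1 - s) * t') * a y + (1 - r) * (s * t + (1 - s) * t') * a' y
   + (u * (s * (1 - t) + (1 - s) * (1 - t')) * b y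
      + (1 - u) * (s * (1 - t) + (1 - s) * (1 - t')) * b' y)); first by ring.
  by rewrite r1 r2 u1 u2; ring.
- move=> [[[t a] b] /= [[+ Aa] Bb] qE]; rewrite /= in_itv/= => t01.
  have [t0|tn0] := eqVneq t 0; first by apply: nBq; rewrite -qE /m/= t0 mix0.
  have [t1|tn1] := eqVneq t 1; first by apply: nAq; rewrite -qE /m/= t1 mix1.
  have t01' : 0 < t < 1 by rewrite !lt_neqAle eq_sym tn0 tn1.
  have ab := exq a b t (AC _ Aa) (BC _ Bb) t01' (esym qE).
  by apply: nAq; rewrite -qE /m/= -ab mixff.
- move=> f [Af|Bf]; [exists (1, f, b0)|exists (0, a0, f)]; rewrite /m/= ?mix1 ?mix0//.
    by rewrite /S/= in_itv/= ler01 lexx.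
  by rewrite /S/= in_itv/= ler01 lexx.
Qed.

Lemma compact_closedE (A : set E) : compact A -> closed A.
Proof. by apply: compact_closed; exact: ptws_hausdorff. Qed.

(** Outside a basic neighbourhood, [C] is a finite union of compact convex pieces, two half-spaces
    for each coordinate. None contains [q], so they can be joined one by one; the bit of [H] is the
    sign of the half-space. *)
Lemma extreme_convex_nbhs_compl (q : E) (s : seq Y) (e : R) :
  mix_extreme C q -> 0 < e ->
  exists A : set E, [/\ A `<=` C, compact A, mix_convex A, ~ A q &
    forall f, C f -> ~ A f -> basic_nbhs q s e f].
Proof.
move=> exq e0; elim: s => [|y s [A [AC cA vA nAq Anb]]].
  by exists set0; split => //; exact: compact0.
pose H b := C `&` [set f : E | e <= (-1) ^+ (b : bool) * (f y - q y)].
have cH b : compact (H b).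
  apply: compact_closedI => //.
  apply: (@ptws_eval_closed R Y y [set r | e <= (-1) ^+ b * (r - q y)]).
  case: b.
    rewrite (_ : [set _ | _] = [set r | r <= q y - e]); first exact: closed_le.
    by apply/seteqP; split=> r /=; lra.
  rewrite (_ : [set _ | _] = [set r | q y + e <= r]); first exact: closed_ge.
  by apply/seteqP; split=> r /=; lra.
have vH b : mix_convex (H b).
  move=> f g t [Cf Hf] [Cg Hg] /[dup] t01' /andP[t0 t1]; split; first exact: vC.
  move: Hf Hg; rewrite /H /mix /=; set k := (_ ^+ _) => Hf Hg.
  rewrite (_ : k * _ = t * (k * (f y - q y)) + (1 - t) * (k * (g y - q y))); last by ring.
  by nra.
have nHq b : ~ H b q by case; rewrite /= subrr mulr0 leNgt e0.
have HC b : H b `<=` C by move=> f [].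
have [D [DC cD vD nDq ABD]] :=
  compact_convex_join exq AC (HC true) cA (cH true) vA (vH true) nAq (nHq true).
have [D' [D'C cD' vD' nD'q ABD']] :=
  compact_convex_join exq DC (HC false) cD (cH false) vD (vH false) nDq (nHq false).
exists D'; split => // f Cf nD'f z; rewrite inE => /orP[/eqP->|]; last first.
  by apply: Anb => // Af; apply: nD'f; apply: ABD'; left; apply: ABD; left.
rewrite ltNge; apply/negP => ef; apply: nD'f; apply: ABD'.
have [fq|fq] := leP 0 (f y - q y).
  right; split => //=; rewrite expr0 mul1r; move: ef; rewrite ger0_norm//.
left; apply: ABD; right; split => //=.
by rewrite expr1 mulN1r; move: ef; rewrite ltr0_norm.
Qed.

(** [U] is an open convex thickening of the compact convex set [A] that contains the part of [C]
    outside [V]. *)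
Lemma choquet_nbhs (q : E) (V : set E) : mix_extreme C q -> nbhs q V ->
  exists U, [/\ open U, mix_convex (C `&` U), C `\` U `<=` V & ~ closure (C `&` U) q].
Proof.
move=> exq /nbhs_basicP[s [e [e0 sV]]].
have [A [AC cA vA nAq Anb]] := extreme_convex_nbhs_compl s exq e0.
have : nbhs q (~` A).
  by apply: open_nbhs_nbhs; split => //; apply: closed_openC; exact: compact_closedE.
move=> /nbhs_basicP[s' [e' [e'0 sA]]].
have e'2 : 0 < e' / 2 by rewrite divr_gt0.
(* Half the radius: a point within [e' / 2] of both [q] and some [a] in [A] would put [a] in the
   [e']-neighbourhood of [q], which misses [A]. *)
exists (\bigcup_(a in A) basic_nbhs a s' (e' / 2)); split.
- by apply: bigcup_open => a _; exact: basic_nbhs_open.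
- move=> f g t [Cf [a Aa fa]] [Cg [b Ab gb]] t01; split; first exact: vC.
  exists (mix t a b) => //; first exact: vA.
  move=> y ys; have {}fa := fa y ys; have {}gb := gb y ys; rewrite /mix.
  rewrite (_ : _ - _ = t * (f y - a y) + (1 - t) * (g y - b y)); last by ring.
  apply: le_lt_trans (ler_normD _ _) _; rewrite !normrM.
  case/andP: t01 => t0 t1; rewrite (ger0_norm t0) (@ger0_norm _ (1 - t)); last lra.
  have [->|tn0] := eqVneq t 0; first by rewrite mul0r add0r subr0 mul1r.
  have tp : 0 < t by rewrite lt_neqAle eq_sym tn0.
  have := fa; rewrite -(ltr_pM2l tp) => H1.
  have : (1 - t) * `|g y - b y| <= (1 - t) * (e' / 2).
    by apply: ler_wpM2l; [lra|exact: ltW].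
  by lra.
- move=> f [Cf nUf]; apply: sV; apply: Anb => // Af; apply: nUf.
  by exists f => // y _; rewrite subrr normr0.
- move=> clq.
  have : nbhs q (basic_nbhs q s' (e' / 2)).
    apply: open_nbhs_nbhs; split; first exact: basic_nbhs_open.
    by move=> y _; rewrite subrr normr0.
  move=> /clq [f [[Cf [a Aa fa]] fq]]; apply: (sA a) => // y ys.
  have := fa y ys; have := fq y ys => fq1 fa1.
  rewrite (_ : a y - q y = (f y - q y) - (f y - a y)); last by ring.
  by apply: le_lt_trans (ler_normB _ _) _; lra.
Qed.

(** The sets [u n] grow on [C], and the extreme points outside [u n.+1] avoid [Z n]. The point
    sought is an extreme point missed by their union. *)
Lemma extreme_baire (Z : nat -> set E) (V : set E) :
  (forall j W, open W -> (exists2 q, mix_extreme C q & W q) ->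
    exists W', [/\ open W', W' `<=` W, (exists2 q, mix_extreme C q & W' q) &
      forall f, mix_extreme C f -> W' f -> ~ Z j f]) ->
  open V -> (exists2 q, mix_extreme C q & V q) ->
  exists e, [/\ mix_extreme C e, V e & forall j, ~ Z j e].
Proof.
move=> ndZ oV [q0 exq0 Vq0].
(* An extreme point outside the closure, not just outside [U], makes the complement of the closure
   an open set to which [ndZ] applies. *)
pose good (U : set E) := [/\ open U, mix_convex (C `&` U) &
  exists2 q, mix_extreme C q & ~ closure (C `&` U) q].
have step U j : good U -> exists U', [/\ good U', C `&` U `<=` U' &
    forall f, mix_extreme C f -> ~ U' f -> ~ Z j f].
  move=> [oU vU [q exq nclq]].
  have oW : open (~` closure (C `&` U)) by apply: closed_openC; exact: closed_closure.
  have [W' [oW' W'W [q' exq' W'q'] nZ]] := ndZ j _ oW (ex_intro2 _ _ q exq nclq).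
  have [U' [oU' vU' CU' nclq']] := choquet_nbhs exq' (open_nbhs_nbhs (conj oW' W'q')).
  exists U'; split; first by split => //; exists q'.
    move=> f [Cf Uf]; apply: contrapT => nU'f.
    have /W'W := CU' f (conj Cf nU'f); apply; exact: subset_closure.
  move=> f exf nU'f; apply: nZ => //; apply: CU'; split => //; exact: exf.1.
have [U0 [oU0 vU0 CU0 nclq0]] := choquet_nbhs exq0 (open_nbhs_nbhs (conj oV Vq0)).
have gU0 : good U0 by split => //; exists q0.
pose next (p : nat * {U | good U}) : {U | good U} :=
  let: s := cid (step (sval p.2) p.1 (svalP p.2)) in
  exist _ (sval s) (let: And3 g _ _ := svalP s in g).
pose u := fix u n := if n is m.+1 then next (m, u m) else exist _ U0 gU0.
have uS n : C `&` sval (u n) `<=` sval (u n.+1).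
  by rewrite /= /next /=; case: (cid _) => U' [].
have uZ n f : mix_extreme C f -> ~ sval (u n.+1) f -> ~ Z n f.
  by rewrite /= /next /=; case: (cid _) => U' []; auto.
have uM n k : (n <= k)%N -> C `&` sval (u n) `<=` sval (u k).
  elim: k => [|k IHk]; first by rewrite leqn0 => /eqP-> f [].
  rewrite leq_eqVlt => /orP[/eqP<- f []//|]; rewrite ltnS => nk f [Cf unf].
  by apply: uS; split => //; exact: IHk.
pose U := \bigcup_n sval (u n).
have [|||e exe nUe] := @open_convex_misses_extreme U.
- by apply: bigcup_open => n _; have [] := svalP (u n).
- move=> f g t [Cf [n _ nf]] [Cg [k _ kg]] t01; split; first exact: vC.
  exists (maxn n k) => //; have [_ v _] := svalP (u (maxn n k)).
  apply: (v _ _ _ _ _ t01).2; split => //.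
    by apply: (uM n); rewrite ?leq_maxl.
  by apply: (uM k); rewrite ?leq_maxr.
(* If the union covered [C], compactness would give a single [u n] covering [C], against the extreme
   point that [good] keeps outside it. *)
- apply: contrapT => H.
  have covC f : C f -> U f by move=> Cf; apply: contrapT => nf; apply: H; exists f.
  have /compact_near_coveringP/near_covering_withinP := cC.
  move=> /(_ nat \oo (fun n f => sval (u n) f)); case.
    move=> f Cf; have [n _ nf] := covC f Cf.
    exists (sval (u n), [set k | (n <= k)%N]).
      split; last by exists n.
      by apply: open_nbhs_nbhs; split => //; have [] := svalP (u n).
    by move=> [g k] /= [ng nk] Cg; apply: (uM n).
  move=> n _ /(_ n (leqnn n)) Cn; have [_ _ [q exq nclq]] := svalP (u n).
  apply: nclq; apply: subset_closure; have Cq := exq.1; split => //; exact: Cn.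
- exists e; split => //.
    apply: CU0; split; first exact: exe.1.
    by move=> U0e; apply: nUe; exists 0%N.
  by move=> j; apply: uZ => // ue; apply: nUe; exists j.+1.
Qed.

End Extreme.

(** * Scalars *)

(* The real and the complex case are treated at once: [K] is [R] with [unitJ = 0] and
   [im = 0], or [R[i]] with [unitJ = 'i]. *)
Class scalar_model (R : realType) (K : numFieldType) (re im : K -> R) := ScalarModel {
  sc : {rmorphism R -> K};
  unitJ : K;
  unitJP : unitJ = 0 \/ unitJ * unitJ = -1;
  sc_le : forall a b, (sc a <= sc b) = (a <= b);
  scalarE : forall z, z = sc (re z) + unitJ * sc (im z);
  re1 : re 1 = 1;
  reD : forall z w, re (z + w) = re z + re w;
  reZ : forall a z, re (sc a * z) = a * re z;
  imE : forall z, im z = re (- unitJ * z);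
  norm_modK : forall z, `|z| = sc (modK re im z);
  ge0_re : forall z, 0 <= z -> z = sc (re z) }.

Section Scalars.
Context {R : realType} {K : numFieldType} {re im : K -> R} {m : scalar_model re im}.
Local Notation sc := (@sc R K re im m).
Local Notation J := (@unitJ R K re im m).
Local Notation abs := (modK re im).
Implicit Types (z w : K) (a b : R).

Lemma sc_inj : injective sc.
Proof. exact: fmorph_inj. Qed.

Lemma sc_lt a b : (sc a < sc b) = (a < b).
Proof. by rewrite !lt_neqAle sc_le (inj_eq sc_inj). Qed.

Lemma re_sc a : re (sc a) = a.
Proof. by rewrite -[sc a]mulr1 reZ re1 mulr1. Qed.

Lemma re0 : re 0 = 0. Proof. by rewrite -(rmorph0 sc) re_sc. Qed.

Lemma reN z : re (- z) = - re z.
Proof. by apply/eqP; rewrite -subr_eq0 opprK -reD addNr re0. Qed.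

Lemma reB z w : re (z - w) = re z - re w.
Proof. by rewrite reD reN. Qed.

Lemma imD z w : im (z + w) = im z + im w.
Proof. by rewrite !imE mulrDr reD. Qed.

Lemma imZ a z : im (sc a * z) = a * im z.
Proof. by rewrite !imE mulrCA reZ. Qed.

Lemma im_sc a : im (sc a) = 0.
Proof.
have := @scalarE _ _ _ _ m (sc a); rewrite re_sc => /eqP.
rewrite addrC -subr_eq subrr eq_sym mulf_eq0 => /orP[/eqP J0|/eqP H].
  by rewrite imE J0 oppr0 mul0r re0.
by apply: sc_inj; rewrite H rmorph0.
Qed.

Lemma imN z : im (- z) = - im z.
Proof. by rewrite !imE mulrN reN. Qed.

Lemma imB z w : im (z - w) = im z - im w.
Proof. by rewrite imD imN. Qed.

Lemma abs_ge0 z : 0 <= abs z. Proof. exact: sqrtr_ge0. Qed.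

Lemma absM z w : abs (z * w) = abs z * abs w.
Proof. by apply: sc_inj; rewrite rmorphM /= -!norm_modK normrM. Qed.

Lemma absD z w : abs (z + w) <= abs z + abs w.
Proof. by rewrite -sc_le rmorphD /= -!norm_modK ler_normD. Qed.

Lemma absN z : abs (- z) = abs z.
Proof. by apply: sc_inj; rewrite -!norm_modK normrN. Qed.

Lemma absB z w : abs (z - w) <= abs z + abs w.
Proof. by rewrite -(absN w) absD. Qed.

Lemma abs0 : abs 0 = 0.
Proof. by apply: sc_inj; rewrite -norm_modK normr0 rmorph0. Qed.

Lemma abs1 : abs 1 = 1.
Proof. by apply: sc_inj; rewrite -norm_modK normr1 rmorph1. Qed.

Lemma abs0_eq0 z : abs z = 0 -> z = 0.
Proof. by move=> z0; apply/normr0_eq0; rewrite norm_modK z0 rmorph0. Qed.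

Lemma abs_eq0 z : (abs z == 0) = (z == 0).
Proof. by apply/eqP/eqP => [/abs0_eq0//|->]; exact: abs0. Qed.

Lemma abs_gt0 z : (0 < abs z) = (z != 0).
Proof. by rewrite lt_neqAle eq_sym abs_eq0 abs_ge0 andbT. Qed.

Lemma abs_sc a : abs (sc a) = `|a|.
Proof. by rewrite /modK re_sc im_sc expr0n addr0 sqrtr_sqr. Qed.

Lemma abs_sqr z : abs z ^+ 2 = re z ^+ 2 + im z ^+ 2.
Proof. by rewrite sqr_sqrtr // addr_ge0 // sqr_ge0. Qed.

Lemma re_le_abs z : `|re z| <= abs z.
Proof. by rewrite -sqrtr_sqr ler_wsqrtr // lerDl sqr_ge0. Qed.

Lemma re_leabs z : re z <= abs z.
Proof. exact: le_trans (ler_norm _) (re_le_abs z). Qed.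

Lemma abs_rotate z : exists2 w, abs w = 1 & w * z = sc (abs z).
Proof.
have [->|z0] := eqVneq z 0; first by exists 1; rewrite ?abs1// mulr0 abs0 rmorph0.
exists (`|z| / z); last by rewrite divfK// -norm_modK.
apply: sc_inj; rewrite -norm_modK normrM normfV normr_id divff ?normr_eq0//.
by rewrite rmorph1.
Qed.

(** The conjugate of [z], which is [z] itself when [unitJ = 0]. *)
Definition cj z : K := sc (re z) - J * sc (im z).

Lemma re_cjM z w : re (cj z * w) = re z * re w + im z * im w.
Proof.
rewrite (_ : cj z * w = sc (re z) * w + sc (im z) * (- J * w)); last first.
  by rewrite /cj; ring.
by rewrite reD !reZ -imE.
Qed.

Lemma im_cjM z w : im (cj z * w) = re z * im w - im z * re w.
Proof.
rewrite (_ : cj z * w = sc (re z) * w + sc (im z) * (- J * w)); last first.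
  by rewrite /cj; ring.
rewrite imD !imZ; congr (_ + _); rewrite -mulrN.
have [HJ|HJ] := @unitJP _ _ _ _ m.
  by rewrite [im z]imE HJ oppr0 !mul0r re0 !mul0r.
by rewrite [im (_ * w)]imE mulrA mulrNN HJ mulN1r reN.
Qed.

Lemma cjM z : cj z * z = sc (abs z ^+ 2).
Proof.
rewrite abs_sqr rmorphD !rmorphXn /= {2}(scalarE z) /cj.
case: unitJP => HJ; last first.
  rewrite (_ : _ * _ = sc (re z) ^+ 2 - J * J * sc (im z) ^+ 2); last by ring.
  by rewrite HJ; ring.
have -> : im z = 0 by rewrite imE HJ oppr0 mul0r re0.
by rewrite rmorph0; ring.
Qed.

End Scalars.

(** * Continuous functionals *)

Section Dual.
Context {R : realType} {K : numFieldType} {re im : K -> R} {m : scalar_model re im}.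
Context {X : normedModType K}.
Local Notation sc := (@sc R K re im m).
Local Notation J := (@unitJ R K re im m).
Local Notation abs := (modK re im).
Implicit Types (x y : X) (f g : X -> K) (a b : R).

(** The norm with values in [R], where suprema and infima exist. *)
Definition nrm x : R := re `|x|.

Lemma normE x : `|x| = sc (nrm x).
Proof. exact: ge0_re. Qed.

Lemma nrm_ge0 x : 0 <= nrm x.
Proof. by rewrite -sc_le rmorph0 -normE. Qed.

Lemma nrmD x y : nrm (x + y) <= nrm x + nrm y.
Proof. by rewrite -sc_le rmorphD /= -!normE ler_normD. Qed.

Lemma nrmZ (k : K) x : nrm (k *: x) = abs k * nrm x.
Proof. by apply: sc_inj; rewrite rmorphM /= -!normE -norm_modK normrZ. Qed.

Lemma nrmZr a x : nrm (sc a *: x) = `|a| * nrm x.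
Proof. by rewrite nrmZ abs_sc. Qed.

Lemma nrm0 : nrm 0 = 0.
Proof. by rewrite -(scale0r 0) nrmZ abs0 mul0r. Qed.

Lemma nrmN x : nrm (- x) = nrm x.
Proof. by rewrite -scaleN1r nrmZ absN abs1 mul1r. Qed.

Lemma nrm_gt0 x : (0 < nrm x) = (x != 0).
Proof.
rewrite lt_neqAle nrm_ge0 andbT eq_sym -(inj_eq (@sc_inj _ _ _ _ m)) rmorph0 -normE.
by rewrite normr_eq0.
Qed.

Lemma norm_le1 x : (`|x| <= 1) = (nrm x <= 1).
Proof. by rewrite -(rmorph1 sc) normE sc_le. Qed.

Definition ball_sup (n : X -> R) (c : R) :=
  (forall x, nrm x <= 1 -> n x <= c) /\
  (forall d, (forall x, nrm x <= 1 -> n x <= d) -> c <= d).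

(** The bound [c] dominates [N 0], so it is nonnegative in [K] and therefore real. *)
Lemma norm_sup_ball (N : X -> K) (n : X -> R) (c : K) :
  (forall x, N x = sc (n x)) -> (forall x, 0 <= n x) ->
  is_norm_sup N c -> c = sc (re c) /\ ball_sup n (re c).
Proof.
move=> NE n0 [cub club].
have c0 : 0 <= c.
  apply: le_trans (cub 0 _); first by rewrite NE -(rmorph0 sc) sc_le.
  by rewrite norm_le1 nrm0 ler01.
have cE : c = sc (re c) := @ge0_re _ _ _ _ m c c0.
split => //; split=> [x x1|d dub].
  by have := cub x; rewrite norm_le1 NE {1}cE sc_le; apply.
rewrite -(@sc_le _ _ _ _ m) -cE; apply: club => x; rewrite norm_le1 NE sc_le.
exact: dub.
Qed.

Lemma ball_norm_sup (N : X -> K) (n : X -> R) (c : R) :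
  (forall x, N x = sc (n x)) -> (forall x, 0 <= n x) ->
  ball_sup n c -> is_norm_sup N (sc c).
Proof.
move=> NE n0 [cub club]; split=> [x|d dub].
  by rewrite norm_le1 NE sc_le; exact: cub.
have d0 : 0 <= d.
  apply: le_trans (dub 0 _); first by rewrite NE -(rmorph0 sc) sc_le.
  by rewrite norm_le1 nrm0 ler01.
rewrite [d](@ge0_re _ _ _ _ m) // sc_le; apply: club => x x1.
by rewrite -(@sc_le _ _ _ _ m) -NE -ge0_re //; apply: dub; rewrite norm_le1.
Qed.

Lemma lfunD f x y : is_linear_functional f -> f (x + y) = f x + f y.
Proof. by move=> lf; rewrite -[x]scale1r lf scale1r mul1r. Qed.

Lemma lfun0 f : is_linear_functional f -> f 0 = 0.
Proof.
by move=> lf; apply/eqP; have /eqP := lfunD 0 0 lf; rewrite addr0 -subr_eq subrr eq_sym.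
Qed.

Lemma lfunZ f (k : K) x : is_linear_functional f -> f (k *: x) = k * f x.
Proof. by move=> lf; rewrite -[k *: x]addr0 lf lfun0 // addr0. Qed.

Lemma lfunN f x : is_linear_functional f -> f (- x) = - f x.
Proof. by move=> lf; rewrite -scaleN1r lfunZ // mulN1r. Qed.

Lemma lfunB f x y : is_linear_functional f -> f (x - y) = f x - f y.
Proof. by move=> lf; rewrite lfunD // lfunN. Qed.

Lemma dual_bound f : dual_elt f ->
  exists2 M, 0 <= M & forall x, abs (f x) <= M * nrm x.
Proof.
move=> [lf [C Cf]]; exists (abs C); first exact: abs_ge0.
move=> x; rewrite -(@sc_le _ _ _ _ m) rmorphM /= -!norm_modK -normE.
apply: le_trans (Cf x) _.
have : 0 <= C * `|x| by exact: le_trans (Cf x).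
by move=> /ger0_norm <-; rewrite normrM normr_id.
Qed.

Lemma dual_intro f M : is_linear_functional f ->
  (forall x, abs (f x) <= M * nrm x) -> dual_elt f.
Proof.
move=> lf fM; split => //; exists (sc M) => x.
by rewrite normE norm_modK -rmorphM sc_le.
Qed.

Lemma dual_lin (k : K) f g : dual_elt f -> dual_elt g ->
  dual_elt (fun x => k * f x + g x).
Proof.
move=> df dg; have [[lf _] [lg _]] := (df, dg).
have [M _ fM] := dual_bound df; have [N _ gN] := dual_bound dg.
apply: (@dual_intro _ (abs k * M + N)).
  by move=> c x y; rewrite lf lg; ring.
move=> x; apply: le_trans (absD _ _) _; rewrite mulrDl absM -mulrA.
by apply: lerD => //; rewrite ler_wpM2l ?abs_ge0.
Qed.

Lemma dual0 : dual_elt (fun _ : X => 0 : K).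
Proof.
apply: (@dual_intro _ 0); first by move=> c x y; rewrite mulr0 addr0.
by move=> x; rewrite abs0 mul0r.
Qed.

Lemma dual_scale (k : K) f : dual_elt f -> dual_elt (fun x => k * f x).
Proof.
move=> df; have := dual_lin k df dual0; congr dual_elt.
by apply/funext => x; rewrite addr0.
Qed.

Lemma dual_sub f g : dual_elt f -> dual_elt g -> dual_elt (fun x => f x - g x).
Proof.
move=> df dg; have := dual_lin (-1) dg df; congr dual_elt.
by apply/funext => x; rewrite mulN1r addrC.
Qed.

Lemma nrm_normalize x : x != 0 -> nrm (sc (nrm x)^-1 *: x) = 1.
Proof.
rewrite -nrm_gt0 => x0.
by rewrite nrmZr gtr0_norm ?invr_gt0// mulVf// gt_eqF.
Qed.

Lemma lfun_le_ball f M : is_linear_functional f ->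
  (forall x, nrm x <= 1 -> abs (f x) <= M) -> forall x, abs (f x) <= M * nrm x.
Proof.
move=> lf fM x; have [->|x0] := eqVneq x 0; first by rewrite lfun0// abs0 nrm0 mulr0.
have := fM (sc (nrm x)^-1 *: x); rewrite nrm_normalize // lexx => /(_ isT).
have nx : 0 < nrm x by rewrite nrm_gt0.
by rewrite lfunZ // absM abs_sc gtr0_norm ?invr_gt0// mulrC ler_pdivrMr.
Qed.

Lemma dual_ballP f : dual_ball f <->
  is_linear_functional f /\ forall x, abs (f x) <= nrm x.
Proof.
split=> [[[lf _] fb]|[lf fb]]; split => //.
- move=> x; rewrite -[nrm x]mul1r; apply: lfun_le_ball => // y y1.
  rewrite -(@sc_le _ _ _ _ m) rmorph1 -norm_modK; apply: fb.
  by rewrite norm_le1.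
- by apply: (@dual_intro _ 1) => // x; rewrite mul1r.
- move=> x; rewrite norm_le1 norm_modK -(rmorph1 sc) sc_le.
  exact: le_trans (fb x).
Qed.

Definition dualnorm f : R := sup [set abs (f x) | x in [set x | nrm x <= 1]].

Lemma dualnorm_sup f : dual_elt f -> ball_sup (fun x => abs (f x)) (dualnorm f).
Proof.
move=> df; have [M M0 fM] := dual_bound df.
have hs : has_sup [set abs (f x) | x in [set x | nrm x <= 1]].
  split; first by exists (abs (f 0)); exists 0; rewrite //= nrm0 ler01.
  exists M => _ [x /= x1 <-]; apply: le_trans (fM x) _.
  by rewrite -[leRHS]mulr1 ler_wpM2l.
split=> [x x1|d dub].
  by apply: (ub_le_sup hs.2); exists x.
by apply: ge_sup; [exact: hs.1|move=> _ [x x1 <-]; exact: dub].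
Qed.

Lemma dualnorm_le f M : dual_elt f -> (forall x, nrm x <= 1 -> abs (f x) <= M) ->
  dualnorm f <= M.
Proof. by move=> /dualnorm_sup[_ H]; exact: H. Qed.

Lemma dualnorm_le_ball f M : dual_elt f -> 0 <= M ->
  (forall x, abs (f x) <= M * nrm x) -> dualnorm f <= M.
Proof.
move=> df M0 fM; apply: dualnorm_le => // x x1; apply: le_trans (fM x) _.
by rewrite -[leRHS]mulr1 ler_wpM2l.
Qed.

Lemma dualnormP f x : dual_elt f -> abs (f x) <= dualnorm f * nrm x.
Proof.
move=> /[dup] df [lf _]; apply: lfun_le_ball => //; exact: (dualnorm_sup df).1.
Qed.

Lemma dualnorm_ge0 f : dual_elt f -> 0 <= dualnorm f.
Proof.
move=> df; apply: le_trans ((dualnorm_sup df).1 0 _); first exact: abs_ge0.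
by rewrite nrm0 ler01.
Qed.

Lemma dualnormZ (k : K) f : dual_elt f -> dualnorm (fun x => k * f x) = abs k * dualnorm f.
Proof.
have leZ c h : dual_elt h -> dualnorm (fun x => c * h x) <= abs c * dualnorm h.
  move=> dh; apply: dualnorm_le_ball; first exact: dual_scale.
    by rewrite mulr_ge0 ?abs_ge0 ?dualnorm_ge0.
  by move=> x; rewrite absM -mulrA ler_wpM2l ?abs_ge0 ?dualnormP.
move=> df; apply/eqP; rewrite eq_le leZ //=.
have [->|k0] := eqVneq k 0.
  by rewrite abs0 mul0r; apply: dualnorm_ge0; exact: dual_scale.
have := leZ k^-1 _ (dual_scale k df).
rewrite (_ : (fun x => k^-1 * (k * f x)) = f); last by apply/funext => x; rewrite mulKf.
move=> H; rewrite -ler_pdivlMl ?abs_gt0 //; apply: le_trans H _.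
rewrite ler_wpM2r ?dualnorm_ge0 //; first exact: dual_scale.
by rewrite -[leRHS]mulr1 -[in leRHS]abs1 -(mulfV k0) absM mulKf // abs_eq0.
Qed.

Lemma dual_ball_dualnorm f : dual_ball f -> dual_elt f /\ dualnorm f <= 1.
Proof.
move=> /[dup] [[df _]] /dual_ballP[lf fb]; split => //.
by apply: dualnorm_le_ball => // x; rewrite mul1r.
Qed.

Lemma dualnorm_ball f : dual_elt f -> dualnorm f <= 1 -> dual_ball f.
Proof.
move=> df f1; apply/dual_ballP; split; first exact: df.1.
move=> x; apply: le_trans (dualnormP x df) _.
by rewrite -[leRHS]mul1r ler_wpM2r ?nrm_ge0.
Qed.

Lemma dualnorm_eq0 f : dual_elt f -> dualnorm f = 0 -> forall x, f x = 0.
Proof.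
move=> df f0 x; have := dualnormP x df; rewrite f0 mul0r => fx.
by apply/(@abs0_eq0 _ _ _ _ m)/eqP; rewrite eq_le fx abs_ge0.
Qed.

End Dual.

(** * Norming functionals and the dual ball *)

Section HahnBanach.
Context {R : realType} {K : numFieldType} {re im : K -> R} {m : scalar_model re im}.
Context {X : normedModType K}.
Local Notation sc := (@sc R K re im m).
Local Notation nrm := (@nrm R K re X).
Implicit Types (p q u : X -> R).

Definition sublinear p := (forall x y, p (x + y) <= p x + p y) /\
  (forall a x, 0 <= a -> p (sc a *: x) = a * p x).

Definition real_linear u := (forall x y, u (x + y) = u x + u y) /\
  (forall a x, u (sc a *: x) = a * u x).

Lemma sublinear0 p : sublinear p -> p 0 = 0.
Proof. by move=> [_ hp]; rewrite -(scale0r 0) -(rmorph0 sc) hp // mul0r. Qed.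

Lemma sublinear_ge p x : sublinear p -> - p (- x) <= p x.
Proof.
move=> sp; have := sp.1 x (- x); rewrite subrr sublinear0 //; lra.
Qed.

Lemma nrm_sublinear : sublinear nrm.
Proof. by split=> [x y|a x a0]; [exact: nrmD|rewrite nrmZr ger0_norm]. Qed.

(* The infimal convolution below lowers [p] to [- p z] at [- z]. *)
Lemma sublinear_lower p z : sublinear p ->
  exists q, [/\ sublinear q, forall x, q x <= p x & q (- z) <= - p z].
Proof.
move=> sp; pose S x := [set p (x + sc t *: z) - t * p z | t in [set t | 0 <= t]].
have S_lb x : lbound (S x) (- p (- x)).
  move=> _ [t /= t0 <-]; have := sp.1 (x + sc t *: z) (- x).
  by rewrite addrAC subrr add0r sp.2 //; lra.
have S_inf x : has_inf (S x).
  split; last by exists (- p (- x)); exact: S_lb.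
  by exists (p (x + sc 0 *: z) - 0 * p z); exists 0 => /=.
have S_le x t : 0 <= t -> inf (S x) <= p (x + sc t *: z) - t * p z.
  by move=> t0; apply: ge_inf; [exact: (S_inf x).2|exists t].
exists (fun x => inf (S x)); split.
- split=> [x y|a x a0].
    rewrite -lerBlDr; apply: lb_le_inf; first exact: (S_inf x).1.
    move=> _ [t /= t0 <-]; rewrite lerBlDr -lerBlDl.
    apply: lb_le_inf; first exact: (S_inf y).1.
    move=> _ [s /= s0 <-].
    have := S_le (x + y) (t + s) (addr_ge0 t0 s0).
    have := sp.1 (x + sc t *: z) (y + sc s *: z).
    by rewrite addrACA -scalerDl -rmorphD /=; lra.
  have [->|an0] := eqVneq a 0.
    rewrite rmorph0 scale0r mul0r; apply/eqP; rewrite eq_le; apply/andP; split.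
      by have := S_le 0 0 (lexx _); rewrite rmorph0 scale0r addr0 sublinear0 // mul0r subr0.
    apply: lb_le_inf; first exact: (S_inf 0).1.
    by move=> _ [t /= t0 <-]; rewrite add0r sp.2 // subrr.
  have ap : 0 < a by rewrite lt_neqAle eq_sym an0.
  have half b w : 0 < b -> inf (S (sc b *: w)) <= b * inf (S w).
    move=> b0; rewrite -ler_pdivrMl //; apply: lb_le_inf; first exact: (S_inf w).1.
    move=> _ [t /= t0 <-]; rewrite ler_pdivrMl //.
    apply: le_trans (S_le _ (b * t) _) _; first by rewrite mulr_ge0 // ltW.
    by rewrite rmorphM -scalerA -scalerDr (sp.2 _ _ (ltW b0)) mulrBr mulrA.
  apply/eqP; rewrite eq_le half //=.
  rewrite -ler_pdivlMl //; apply: le_trans (half _ _ _); last by rewrite invr_gt0.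
  by rewrite scalerA -rmorphM mulVf // rmorph1 scale1r.
- by move=> x; have := S_le x 0 (lexx _); rewrite rmorph0 scale0r addr0 mul0r subr0.
- have := S_le (- z) 1 ler01; rewrite rmorph1 scale1r addNr sublinear0 //; lra.
Qed.

(** A minimal sublinear functional below [p] is linear: lowering it at [- z] cannot change it, so
    its value at [- z] is at most the opposite of its value at [z]. *)
Lemma sublinear_dominates_linear p : sublinear p ->
  exists2 u, real_linear u & forall x, u x <= p x.
Proof.
move=> sp; pose T := {q : X -> R | sublinear q /\ forall x, q x <= p x}.
pose le (q r : T) := `[< forall x, sval r x <= sval q x >].
have [||||[q [sq qp]] qmin] := @Zorn T le.
- by move=> q; apply/asboolP => x.
- by move=> q r s /asboolP qr /asboolP rs; apply/asboolP => x; exact: le_trans (qr x).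
- move=> [q Hq] [r Hr] /asboolP /= qr /asboolP /= rq; apply: eq_exist => /=.
  by apply/funext => x; apply/eqP; rewrite eq_le qr rq.
(* A chain is bounded by its pointwise infimum; subadditivity survives because, of two members of
   the chain, the smaller one can be used at both arguments. *)
- move=> A totA; have [[q0 Aq0]|A0] := pselect (exists q : T, A q); last first.
    exists (exist _ p (conj sp (fun x => lexx (p x)))) => s As.
    by exfalso; apply: A0; exists s.
  pose S x := [set (sval : T -> X -> R) q x | q in A].
  have S_inf x : has_inf (S x).
    split; first by exists (sval q0 x); exists q0.
    exists (- p (- x)) => _ [[q [sq qp]] _ <-] /=.
    by apply: le_trans (sublinear_ge x sq); rewrite lerN2.
  have S_le x (q : T) : A q -> inf (S x) <= sval q x.
    by move=> Aq; apply: ge_inf; [exact: (S_inf x).2|exists q].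
  have sS : sublinear (fun x => inf (S x)).
    split=> [x y|a x a0].
      rewrite -lerBlDr; apply: lb_le_inf; first exact: (S_inf x).1.
      move=> _ [q Aq <-]; rewrite lerBlDr -lerBlDl.
      apply: lb_le_inf; first exact: (S_inf y).1.
      move=> _ [r Ar <-]; rewrite lerBlDl.
      have [/asboolP qr|/asboolP rq] := totA _ _ Aq Ar.
        apply: le_trans (S_le (x + y) r Ar) _.
        by apply: le_trans ((svalP r).1.1 x y) _; rewrite lerD2r.
      apply: le_trans (S_le (x + y) q Aq) _.
      by apply: le_trans ((svalP q).1.1 x y) _; rewrite lerD2l.
    have [->|an0] := eqVneq a 0.
      rewrite rmorph0 scale0r mul0r; apply/eqP; rewrite eq_le; apply/andP; split.
        by apply: le_trans (S_le 0 q0 Aq0) _; rewrite sublinear0 //; exact: (svalP q0).1.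
      apply: lb_le_inf; first exact: (S_inf 0).1.
      by move=> _ [q Aq <-]; rewrite sublinear0 //; exact: (svalP q).1.
    have ap : 0 < a by rewrite lt_neqAle eq_sym an0.
    apply/eqP; rewrite eq_le; apply/andP; split.
      rewrite -ler_pdivrMl //; apply: lb_le_inf; first exact: (S_inf x).1.
      move=> _ [q Aq <-]; rewrite ler_pdivrMl //.
      by apply: le_trans (S_le _ q Aq) _; rewrite (svalP q).1.2.
    apply: lb_le_inf; first exact: (S_inf _).1.
    move=> _ [q Aq <-]; rewrite (svalP q).1.2 // ler_wpM2l //; exact: S_le.
  have Sp x : inf (S x) <= p x by apply: le_trans (S_le x q0 Aq0) _; exact: (svalP q0).2.
  exists (exist _ (fun x => inf (S x)) (conj sS Sp)) => q Aq; apply/asboolP => x /=; exact: S_le.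
have addq x z : q (x + z) = q x + q z.
  apply/eqP; rewrite eq_le sq.1 /=.
  have [r [sr rq rz]] := sublinear_lower z sq.
  have rp w : r w <= p w by exact: le_trans (qp w).
  have /(congr1 sval)/= rqE := qmin (exist _ r (conj sr rp)) (asboolT (fun w => rq w)).
  have := sq.1 (x + z) (- z); rewrite addrK => H.
  by move: rz; rewrite rqE; lra.
exists q => //; split => // a x.
have qN y : q (- y) = - q y.
  by apply/eqP; rewrite -addr_eq0 -addq addNr sublinear0.
have [a0|a0] := leP 0 a; first exact: sq.2.
rewrite -[a]opprK rmorphN scaleNr qN sq.2 ?oppr_ge0 ?ltW //; lra.
Qed.

(** Lowering the norm at [- x0] first forces every linear functional below the result to take at
    least the value [nrm x0] at [x0]. *)
Lemma norming_functional x0 :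
  exists u, [/\ real_linear u, forall x, u x <= nrm x & u x0 = nrm x0].
Proof.
have [q [sq qn qz]] := sublinear_lower x0 nrm_sublinear.
have [u lu uq] := sublinear_dominates_linear sq.
exists u; split => //; first by move=> x; exact: le_trans (qn x).
have uN : u (- x0) = - u x0 by rewrite -[- x0]scaleN1r -(rmorph1 sc) -rmorphN lu.2 mulN1r.
apply/eqP; rewrite eq_le (le_trans (uq _) (qn _)) /=.
by have := uq (- x0); rewrite uN; lra.
Qed.

End HahnBanach.

(** * The dual ball as a compact convex set of real functions *)

Section Ball.
Context {R : realType} {K : numFieldType} {re im : K -> R} {m : scalar_model re im}.
Context {X : normedModType K}.
Local Notation sc := (@sc R K re im m).
Local Notation J := (@unitJ R K re im m).
Local Notation abs := (modK re im).
Local Notation nrm := (@nrm R K re X).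
Local Notation E := {ptws X -> R}.
Local Notation real_linear := (@real_linear R K re im m X).
Implicit Types (u : E) (f g : X -> K).

(** The real parts of the elements of the dual ball. They determine the functionals through [fn],
    and pointwise convergence of real parts is weak-star convergence. *)
Definition rball : set E := [set u | real_linear u /\ forall x, u x <= nrm x].

Definition fn (u : X -> R) : X -> K := fun x => sc (u x) + J * sc (u (- J *: x)).

Lemma real_linearN u x : real_linear u -> u (- x) = - u x.
Proof. by move=> lu; rewrite -scaleN1r -(rmorph1 sc) -rmorphN lu.2 mulN1r. Qed.

Lemma re_fn u x : re (fn u x) = u x.
Proof.
rewrite /fn reD re_sc -[RHS]addr0; congr (_ + _).
by apply/eqP; rewrite -oppr_eq0 -reN -mulNr -imE im_sc.
Qed.

Lemma fn_linear u : real_linear u -> is_linear_functional (fn u).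
Proof.
move=> lu.
have fnD x y : fn u (x + y) = fn u x + fn u y.
  by rewrite /fn scalerDr !lu.1 !rmorphD /=; ring.
have fnr (a : R) x : fn u (sc a *: x) = sc a * fn u x.
  rewrite /fn scalerA [- J * _]mulrC -scalerA !lu.2 !rmorphM /=; ring.
have fnJ x : fn u (J *: x) = J * fn u x.
  have u0 : u 0 = 0 by rewrite -(scale0r 0) -(rmorph0 sc) lu.2 mul0r.
  rewrite /fn; case: unitJP => HJ.
    by rewrite HJ !mul0r scale0r u0 rmorph0 addr0.
  rewrite scalerA mulNr HJ opprK scale1r scaleNr real_linearN // rmorphN /=.
  by rewrite mulrDr mulrA HJ; ring.
move=> k x y; rewrite fnD; congr (_ + _).
rewrite [k](@scalarE _ _ _ _ m) scalerDl fnD fnr -scalerA fnJ fnr; ring.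
Qed.

Lemma fn_re f : is_linear_functional f -> fn (fun x => re (f x)) = f.
Proof.
move=> lf; apply/funext => x; rewrite /fn (lfunZ (- J) x lf).
by rewrite -(@imE _ _ _ _ m) -scalarE.
Qed.

Lemma re_real_linear f : is_linear_functional f -> real_linear (fun x => re (f x)).
Proof.
by move=> lf; split=> [x y|a x]; [rewrite lfunD // reD|rewrite lfunZ // reZ].
Qed.

Lemma dual_ball_re f : dual_ball f -> rball (fun x => re (f x)).
Proof.
move=> /(@dual_ballP _ _ _ _ m)[lf fb]; split; first exact: re_real_linear.
by move=> x; apply: le_trans (fb x); exact: re_leabs.
Qed.

Lemma rball_dual_ball u : rball u -> dual_ball (fn u).
Proof.
move=> [lu un]; apply/(@dual_ballP _ _ _ _ m); have lf := fn_linear lu.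
(* Rotating [x] makes the value of [fn u] real and nonnegative, where the bound on [u] applies. *)
split => // x; have [w w1 wz] := @abs_rotate _ _ _ _ m (fn u x).
have : re (fn u (w *: x)) = abs (fn u x) by rewrite lfunZ // wz re_sc.
by rewrite re_fn => <-; apply: le_trans (un _) _; rewrite nrmZ w1 mul1r.
Qed.

Lemma rball_abs u x : rball u -> `|u x| <= nrm x.
Proof.
move=> [lu un]; rewrite ler_norml un andbT lerNl -(real_linearN x lu).
by apply: le_trans (un _) _; rewrite nrmN.
Qed.

Lemma rball_convex : mix_convex rball.
Proof.
move=> f g t [lf nf] [lg ng] /andP[t0 t1]; split.
  by split=> [x y|a x]; rewrite /mix ?lf.1 ?lg.1 ?lf.2 ?lg.2; ring.
move=> x; have := nf x; have := ng x; rewrite /mix; nra.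
Qed.

(** Banach-Alaoglu: additivity and homogeneity cut a closed set out of a product of compact
    intervals. *)
Lemma rball_compact : compact rball.
Proof.
have /= cB := @tychonoff X (fun=> R) (fun x => `[- nrm x, nrm x]%classic)
  (fun x => @segment_compact R _ _).
rewrite (_ : rball = [set u : E | forall x, `[- nrm x, nrm x]%classic (u x)] `&`
  ([set u : E | forall x y, u (x + y) - (u x + u y) = 0] `&`
   [set u : E | forall a x, u (sc a *: x) - a * u x = 0])); last first.
  apply/seteqP; split=> u.
    move=> ru; have [[uD uZ] un] := ru; split=> [x /=|].
      by rewrite in_itv/= -ler_norml rball_abs.
    by split=> [x y|a x]; rewrite ?uD ?uZ subrr.
  move=> [un [uD uZ]]; split; last by move=> x; have := un x; rewrite /= in_itv/= => /andP[].
  by split=> [x y|a x]; apply/eqP; rewrite -subr_eq0; [rewrite uD|rewrite uZ].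
have closed_eq0 (h : E -> R) : (forall u, h @ nbhs u --> h u) -> closed [set u | h u = 0].
  move=> ch; have /continuous_closedP/(_ [set 0]) : continuous h := ch.
  by apply; exact: closed_eq.
apply: compact_closedI => //; apply: closedI.
- rewrite (_ : [set _ | _] = \bigcap_(p in [set: X * X])
      [set u : E | u (p.1 + p.2) - (u p.1 + u p.2) = 0]); last first.
    by apply/seteqP; split=> [u H [x y] _|u H x y]; [exact: H|exact: (H (x, y))].
  apply: closed_bigI => -[x y] _; apply: closed_eq0 => u /=.
  have c z := @ptws_eval_continuous R X z u.
  exact: (@cvgB _ R^o _ _ _ _ _ _ _ (c _) (@cvgD _ R^o _ _ _ _ _ _ _ (c _) (c _))).
- rewrite (_ : [set _ | _] = \bigcap_(p in [set: R * X])
      [set u : E | u (sc p.1 *: p.2) - p.1 * u p.2 = 0]); last first.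
    by apply/seteqP; split=> [u H [a x] _|u H a x]; [exact: H|exact: (H (a, x))].
  apply: closed_bigI => -[a x] _; apply: closed_eq0 => u /=.
  have c z := @ptws_eval_continuous R X z u.
  exact: (@cvgB _ R^o _ _ _ _ _ _ _ (c _) (cvgM (cvg_cst a) (c _))).
Qed.

(** Taking real parts and [fn] are inverse affine bijections between the dual ball and [rball], so
    they match the extreme points; the converse is the next lemma. *)
Lemma dual_ext_re f : dual_ext f -> mix_extreme rball (fun x => re (f x)).
Proof.
move=> [bf exf]; split; first exact: dual_ball_re.
move=> g h t rg rh /andP[t0 t1] fgh.
have lf := bf.1.1.
have H : forall x, f x = sc t * fn g x + (1 - sc t) * fn h x.
  have lm : is_linear_functional (fun x => sc t * fn g x + (1 - sc t) * fn h x).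
    by move=> k x y; rewrite (fn_linear rg.1) (fn_linear rh.1); ring.
  move=> x; rewrite -[in LHS](fn_re lf) -[RHS](congr1 (@^~ x) (fn_re lm)).
  congr (fn _ x); apply/funext => y; rewrite -[1 in RHS](rmorph1 sc) -rmorphB.
  by rewrite reD !reZ !re_fn; exact: (congr1 (@^~ y) fgh).
have t01 : 0 < sc t < 1 by rewrite -(rmorph0 sc) -(rmorph1 sc) !sc_lt t0 t1.
have gh := exf _ _ _ (rball_dual_ball rg) (rball_dual_ball rh) t01 H.
by apply/funext => x; rewrite -[LHS]re_fn gh re_fn.
Qed.

Lemma extreme_dual_ext u : mix_extreme rball u -> dual_ext (fn u).
Proof.
move=> [ru exu]; split; first exact: rball_dual_ball.
move=> g h t bg bh /andP[t0 t1] H x.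
have tE := @ge0_re _ _ _ _ m t (ltW t0).
have t01 : 0 < re t < 1.
  by rewrite -!(@sc_lt _ _ _ _ m) -tE rmorph0 rmorph1 t0 t1.
have lg := bg.1.1; have lh := bh.1.1.
have : (fun x => re (g x)) = (fun x => re (h x)).
  apply: (exu _ _ _ (dual_ball_re bg) (dual_ball_re bh) t01).
  apply/funext => y; rewrite -[LHS]re_fn H {1}tE /mix.
  rewrite -[1](rmorph1 sc) {2}tE -rmorphB reD !reZ //.
by move=> gh; rewrite -(fn_re lg) gh fn_re.
Qed.

End Ball.

(** * Extreme points of the dual ball of an L1-predual *)

Section Atoms.
Context {R : realType} {K : numFieldType} {re im : K -> R} {m : scalar_model re im}.
Context {X : normedModType K}.
Local Notation sc := (@sc R K re im m).
Local Notation J := (@unitJ R K re im m).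
Local Notation abs := (modK re im).
Local Notation nrm := (@nrm R K re X).
Local Notation dualnorm := (@dualnorm R K re im X).
Implicit Types (f g p q : X -> K).

(* [phi] is the coefficient functional of an L-projection of [X^*] onto the span of [p]. *)
Definition atom p (phi : (X -> K) -> K) := [/\
  forall (k : K) f g, dual_elt f -> dual_elt g ->
    phi (fun x => k * f x + g x) = k * phi f + phi g,
  phi p = 1 &
  forall f, dual_elt f -> dualnorm f = abs (phi f) + dualnorm (fun x => f x - phi f * p x)].

(** Zero is the midpoint of [u] and [- u] for a norming functional [u] of a nonzero vector, and a
    [p] of norm strictly between 0 and 1 lies between 0 and its normalisation. *)
Lemma dual_ext_dualnorm p : (exists x : X, x != 0) -> dual_ext p -> dualnorm p = 1.
Proof.
move=> [x0 x00] [bp exp]; have [dp p1] := @dual_ball_dualnorm _ _ _ _ m _ _ bp.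
have sc01 t : 0 < t < 1 -> 0 < sc t < 1.
  by rewrite -(rmorph0 sc) -(rmorph1 sc) !sc_lt.
have bscale k f : dual_ball f -> abs k <= 1 -> dual_ball (fun x => k * f x).
  move=> /(@dual_ballP _ _ _ _ m)[lf fb] k1; apply/(@dual_ballP _ _ _ _ m); split.
    by move=> a x y; rewrite lf; ring.
  by move=> x; rewrite absM -[leRHS]mul1r ler_pM ?abs_ge0.
have p0 : ~ forall x, p x = 0.
  move=> p0; have [u [lu un ux]] := @norming_functional _ _ _ _ m X x0.
  have bu : dual_ball (fn u) by apply: rball_dual_ball.
  have h : 0 < (2^-1 : R) < 1 by rewrite invr_gt0 ltr0n invf_lt1 ?ltr0n ?ltr1n.
  have bNu : dual_ball (fun x => (-1) * fn u x) by apply: bscale; rewrite // absN abs1.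
  have H : forall x, fn u x = -1 * fn u x.
    apply: (exp _ _ _ bu bNu (sc01 _ h)) => x.
    rewrite p0 (_ : 1 - sc 2^-1 = sc 2^-1); first by ring.
    by rewrite -(rmorph1 sc) -rmorphB; congr (sc _); lra.
  have /(congr1 re) := H x0; rewrite mulN1r reN re_fn ux.
  by move: x00; rewrite -(@nrm_gt0 _ _ _ _ m); lra.
apply/eqP; rewrite eq_le p1 /= leNgt; apply/negP => plt.
have s0 : 0 < dualnorm p.
  rewrite lt_neqAle (@dualnorm_ge0 _ _ _ _ m) // andbT eq_sym; apply/eqP => H; apply: p0.
  exact: (@dualnorm_eq0 _ _ _ _ m).
have s01 : 0 < dualnorm p < 1 by rewrite s0.
have b1 : dual_ball (fun x => sc (dualnorm p)^-1 * p x).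
  apply: (@dualnorm_ball _ _ _ _ m); first exact: dual_scale.
  by rewrite dualnormZ // abs_sc gtr0_norm ?invr_gt0 // mulVf ?gt_eqF.
have b0 : dual_ball (fun x => 0 * p x) by apply: bscale; rewrite // abs0 ler01.
have H : forall x, sc (dualnorm p)^-1 * p x = 0 * p x.
  apply: (exp _ _ _ b1 b0 (sc01 _ s01)) => x.
  by rewrite mul0r mulr0 addr0 mulrA -rmorphM mulfV ?gt_eqF // rmorph1 mul1r.
apply: p0 => x; have /eqP := H x.
by rewrite mul0r mulf_eq0 fmorph_eq0 invr_eq0 gt_eqF //= => /eqP.
Qed.

(** * Extreme points are carried by atoms of the measure *)

Section L1.
Context {d : measure_display} {Om : measurableType d}.
Variables (mu : {measure set Om -> \bar R}) (Phi : (X -> K) -> Om -> K).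
Hypothesis mPhi : forall f, dual_elt f ->
       measurable_fun setT (fun w => re (Phi f w)) /\
       measurable_fun setT (fun w => im (Phi f w)).
Hypothesis linPhi : forall (a : K) f g, dual_elt f -> dual_elt g ->
       {ae mu, forall w, Phi (fun x => a * f x + g x) w = a * Phi f w + Phi g w}.
Hypothesis isoPhi : forall f (c : K), dual_elt f -> is_norm_sup (fun x => `|f x|) c ->
       (\int[mu]_w (modK re im (Phi f w))%:E = (re c)%:E)%E.
Hypothesis surjPhi : forall g : Om -> K,
       measurable_fun setT (fun w => re (g w)) ->
       measurable_fun setT (fun w => im (g w)) ->
       (\int[mu]_w (modK re im (g w))%:E < +oo)%E ->
       exists f, dual_elt f /\ {ae mu, forall w, Phi f w = g w}.

Definition Kmeasurable (g : Om -> K) :=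
  measurable_fun setT (fun w => re (g w)) /\ measurable_fun setT (fun w => im (g w)).

Lemma measurable_abs (g : Om -> K) : Kmeasurable g -> measurable_fun setT (fun w => abs (g w)).
Proof.
move=> [mr mi]; apply: (measurableT_comp (f := @Num.sqrt R)).
  by apply: continuous_measurable_fun; exact: sqrt_continuous.
by apply: measurable_funD; apply: measurable_funX.
Qed.

Lemma measurable_Eabs (g : Om -> K) : Kmeasurable g ->
  measurable_fun setT (fun w => (abs (g w))%:E).
Proof. by move=> mg; apply/measurable_EFinP; exact: measurable_abs. Qed.

Lemma int_Phi f : dual_elt f -> (\int[mu]_w (abs (Phi f w))%:E = (dualnorm f)%:E)%E.
Proof.
move=> df; rewrite (@isoPhi f (sc (dualnorm f))) ?re_sc //.
apply: (@ball_norm_sup _ _ _ _ m _ _ (fun x => abs (f x))).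
- by move=> x; rewrite norm_modK.
- by move=> x; exact: abs_ge0.
- exact: (@dualnorm_sup _ _ _ _ m).
Qed.

Lemma int_ae_eq (u v : Om -> R) : measurable_fun setT u -> measurable_fun setT v ->
  {ae mu, forall w, u w = v w} -> (\int[mu]_w (u w)%:E = \int[mu]_w (v w)%:E)%E.
Proof.
move=> mu_ mv uv; apply: ae_eq_integral => //; try exact/measurable_EFinP.
by apply: filterS uv => w -> _.
Qed.

Lemma Phi0 : {ae mu, forall w, Phi (fun=> 0) w = 0}.
Proof.
have := linPhi (-1) (@dual0 _ _ _ _ m X) (@dual0 _ _ _ _ m X).
rewrite (_ : (fun x : X => -1 * 0 + 0) = fun=> 0 :> K); last first.
  by apply/funext => x; rewrite mulr0 addr0.
by apply: filterS => w ->; rewrite mulN1r addNr.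
Qed.

Variable p : X -> K.
Hypotheses (X0 : exists x : X, x != 0) (exp : dual_ext p).
Let dp : dual_elt p := exp.1.1.
Let G : set Om := [set w | Phi p w != 0].

Lemma support_not_null : ~ {ae mu, forall w, ~ G w}.
Proof.
move=> nG; have := int_Phi dp; rewrite dual_ext_dualnorm //.
rewrite (@int_ae_eq _ (fun=> 0)); first by rewrite integral0 => -[/eqP]; rewrite eq_sym oner_eq0.
- by apply: measurable_abs; exact: mPhi.
- exact: measurable_cst.
- by apply: filterS nG => w /negP; rewrite negbK => /eqP ->; rewrite abs0.
Qed.

(** Cutting [Phi p] along [B] splits [p] into [q] and [p - q], whose norms add up to 1. Extremality
    makes [q] a multiple of [p], so the indicator of [B] is almost everywhere constant on the
    support [G]. *)
Lemma support_dichotomy (B : set Om) : measurable B ->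
  {ae mu, forall w, G w -> B w} \/ {ae mu, forall w, G w -> ~ B w}.
Proof.
move=> mB; have [mr mi] := mPhi dp.
pose gB w : K := sc (\1_B w) * Phi p w.
have m1 : measurable_fun setT (\1_B : Om -> R) by exact: measurable_indic.
have mgB : Kmeasurable gB.
  split.
    under eq_fun do rewrite /gB reZ.
    exact: measurable_funM.
  under eq_fun do rewrite /gB imZ.
  exact: measurable_funM.
have absB w : abs (gB w) = \1_B w * abs (Phi p w).
  by rewrite /gB absM abs_sc ger0_norm // indicE ler0n.
have fin : (\int[mu]_w (abs (gB w))%:E < +oo)%E.
  apply: (@le_lt_trans _ _ (\int[mu]_w (abs (Phi p w))%:E)%E).
    apply: ge0_le_integral => //.
    - by move=> w _; rewrite lee_fin abs_ge0.
    - exact: measurable_Eabs.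
    - by apply: measurable_Eabs; exact: mPhi.
    - move=> w _; rewrite lee_fin absB indicE.
      by case: (_ \in _); rewrite ?mul1r ?mul0r ?abs_ge0.
  by rewrite int_Phi // ltry.
have [q [dq qB]] := surjPhi mgB.1 mgB.2 fin.
have dpq : dual_elt (fun x => -1 * q x + p x) by exact: dual_lin.
have PhiC : {ae mu, forall w, Phi (fun x => -1 * q x + p x) w = sc (1 - \1_B w) * Phi p w}.
  apply: filterS2 (linPhi (-1) dq dp) qB => w -> ->.
  by rewrite /gB rmorphB rmorph1; ring.
have sum1 : dualnorm q + dualnorm (fun x => -1 * q x + p x) = 1.
  apply: EFin_inj; rewrite EFinD -!int_Phi // -ge0_integralD //.
  - rewrite -(dual_ext_dualnorm X0 exp) -int_Phi //.
    under eq_integral do rewrite -EFinD.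
    apply: int_ae_eq.
    + by apply: measurable_funD; apply: measurable_abs; exact: mPhi.
    + by apply: measurable_abs; exact: mPhi.
    + apply: filterS2 qB PhiC => w -> ->; rewrite absB absM abs_sc -mulrDl indicE.
      by case: (_ \in _); rewrite /= ?subrr ?subr0 ?normr0 ?normr1 ?addr0 ?add0r mul1r.
  - by move=> w _; rewrite lee_fin abs_ge0.
  - by apply: measurable_Eabs; exact: mPhi.
  - by move=> w _; rewrite lee_fin abs_ge0.
  - by apply: measurable_Eabs; exact: mPhi.
have inB w : \1_B w = (1 : R) -> B w.
  by rewrite indicE; case: (boolP (w \in B)) => [/set_mem//|_ /esym/eqP]; rewrite oner_eq0.
have inC w : \1_B w = (0 : R) -> ~ B w.
  by rewrite indicE; case: (boolP (w \in B)) => [_ /eqP|/negP + _ Bw]; rewrite ?oner_eq0// inE.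
have [q0|qn0] := eqVneq (dualnorm q) 0.
  right; have q0E : q = fun=> 0 by apply/funext; exact: (@dualnorm_eq0 _ _ _ _ m).
  have := Phi0; rewrite -q0E => P0; apply: filterS2 qB P0 => w qw q0w Gw.
  apply: inC; apply/eqP; move: qw; rewrite q0w /gB => /esym/eqP.
  by rewrite mulf_eq0 fmorph_eq0 (negbTE Gw) orbF.
have [q1|qn1] := eqVneq (dualnorm q) 1.
  left; have r0 : dualnorm (fun x => -1 * q x + p x) = 0 by lra.
  have rE : (fun x => -1 * q x + p x) = fun=> 0.
    by apply/funext; exact: (@dualnorm_eq0 _ _ _ _ m).
  have := Phi0; rewrite -rE => P0; apply: filterS2 PhiC P0 => w qw q0w Gw.
  apply: inB; apply/eqP; move: qw; rewrite q0w => /esym/eqP.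
  by rewrite mulf_eq0 fmorph_eq0 (negbTE Gw) orbF subr_eq0 eq_sym.
(* Now [p] is a proper mixture of the normalised pieces, so [q] is [t] times [p] and the indicator
   of [B] equals [t] almost everywhere on [G]. With [t] strictly between 0 and 1 no point of [G]
   satisfies this, so either alternative may be claimed. *)
right; set t := dualnorm q in sum1 qn0 qn1.
have t0 : 0 < t by rewrite lt_neqAle eq_sym qn0 (@dualnorm_ge0 _ _ _ _ m).
have t1 : t < 1.
  by rewrite lt_neqAle qn1 -sum1 lerDl (@dualnorm_ge0 _ _ _ _ m).
have sctn : sc t != 0 by rewrite fmorph_eq0.
have sc1tn : 1 - sc t != 0.
  by rewrite -(rmorph1 sc) -rmorphB fmorph_eq0 subr_eq0 eq_sym.
have b1 : dual_ball (fun x => sc t^-1 * q x).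
  apply: (@dualnorm_ball _ _ _ _ m); first exact: dual_scale.
  by rewrite dualnormZ // abs_sc gtr0_norm ?invr_gt0 // mulVf.
have b2 : dual_ball (fun x => sc (1 - t)^-1 * (-1 * q x + p x)).
  apply: (@dualnorm_ball _ _ _ _ m); first exact: dual_scale.
  rewrite dualnormZ // abs_sc gtr0_norm ?invr_gt0 ?subr_gt0 //.
  have -> : dualnorm (fun x => -1 * q x + p x) = 1 - t by lra.
  by rewrite mulVf // subr_eq0 eq_sym.
have t01 : 0 < sc t < 1 by rewrite -(rmorph0 sc) -(rmorph1 sc) !sc_lt t0.
have eqq : forall x, sc t^-1 * q x = sc (1 - t)^-1 * (-1 * q x + p x).
  apply: (exp.2 _ _ (sc t)) => // x.
  rewrite !fmorphV /= rmorphB rmorph1 !mulrA !mulfV // !mul1r; ring.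
have qE : q = fun x => sc t * p x + 0.
  apply/funext => x; have := eqq x; rewrite !fmorphV /= rmorphB rmorph1 => H.
  have : (1 - sc t) * q x = sc t * (-1 * q x + p x).
    rewrite -[q x in LHS](mulVKf sctn) H mulrCA.
    by rewrite mulVKf.
  move=> H'; transitivity ((1 - sc t) * q x + sc t * q x); first by ring.
  by rewrite H'; ring.
have := linPhi (sc t) dp (@dual0 _ _ _ _ m X); rewrite -qE => qt.
have {}qt : {ae mu, forall w, Phi q w = sc t * Phi p w}.
  by apply: filterS2 qt Phi0 => w -> ->; rewrite addr0.
apply: filterS2 qB qt => w qw qtw Gw.
apply: inC; move: qw; rewrite qtw /gB => /(mulIf Gw)/(@sc_inj _ _ _ _ m).
by rewrite indicE; case: (_ \in _) => //= tt; move: t1; rewrite tt ltxx.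
Qed.

(** By the dichotomy, each level [r] bounds the quotient from below or strictly from above almost
    everywhere on [G]; the constant is the supremum of the lower bounds. It is finite because [G] is
    not null. *)
Lemma support_constant (v a : Om -> R) : measurable_fun setT v ->
  measurable_fun setT a -> (forall w, G w -> 0 < a w) ->
  exists c, {ae mu, forall w, G w -> v w / a w = c}.
Proof.
(* The level sets of the quotient are written without division, which makes them measurable at once
   and agrees with the quotient on [G]. *)
move=> mv ma a0; pose u w := v w / a w; pose B r := [set w | v w < r * a w].
have mB r : measurable (B r).
  have := measurable_fun_ltr mv (measurable_funM (measurable_cst r) ma).
  by move=> /(_ measurableT [set true] I); rewrite setTI.
have BE r w : G w -> B r w = (u w < r) :> Prop.
  by move=> /a0 aw; rewrite /B /u /= ltr_pdivrMr.
have dich r := support_dichotomy (mB r).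
pose S := [set r | {ae mu, forall w, G w -> ~ B r w}].
have Sdown r s : S r -> s <= r -> S s.
  move=> Sr sr; apply: filterS Sr => w H Gw Bw; apply: (H Gw).
  by move: Bw; rewrite !BE // => /lt_le_trans; apply.
have hS : has_sup S.
  split.
    apply: contrapT => S0; apply: support_not_null.
    have : forall n : nat, {ae mu, forall w, G w -> B (- n%:R) w}.
      by move=> n; have [//|Sn] := dich (- n%:R); exfalso; apply: S0; exists (- n%:R).
    move=> /ae_foralln; apply: filterS => w H Gw.
    have [n un] : exists n : nat, - u w <= n%:R.
      exists (Num.bound `|u w|); apply: ltW; apply: le_lt_trans (archi_boundP (normr_ge0 _)).
      by rewrite -normrN ler_norm.
    by have := H n Gw; rewrite BE // ltNge; move/negP; apply; rewrite lerNl.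
  apply: contrapT => Sub; apply: support_not_null.
  have : forall n : nat, {ae mu, forall w, G w -> ~ B n%:R w}.
    move=> n; have [Bn|//] := dich n%:R; exfalso; apply: Sub; exists n%:R => s Ss.
    rewrite leNgt; apply/negP => ns; apply: support_not_null.
    by apply: filterS2 Bn (Sdown _ _ Ss (ltW ns)) => w H1 H2 Gw; exact: H2 (H1 Gw).
  move=> /ae_foralln; apply: filterS => w H Gw.
  have [n un] : exists n : nat, u w < n%:R.
    exists (Num.bound `|u w|); apply: le_lt_trans (ler_norm _) _.
    exact: archi_boundP.
  by apply: (H n Gw); rewrite BE.
exists (sup S).
have lo n : {ae mu, forall w, G w -> ~ B (sup S - n.+1%:R^-1) w}.
  have n0 : 0 < n.+1%:R^-1 :> R by rewrite invr_gt0 ltr0n.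
  have [s Ss slt] := sup_adherent n0 hS.
  by apply: (Sdown s) => //; exact: ltW.
have hi n : {ae mu, forall w, G w -> B (sup S + n.+1%:R^-1) w}.
  have [//|Sn] := dich (sup S + n.+1%:R^-1); exfalso.
  have := ub_le_sup hS.2 Sn; rewrite leNgt; apply/negP/negPn.
  by rewrite ltrDl invr_gt0 ltr0n.
apply: filterS2 (ae_foralln lo) (ae_foralln hi) => w l h Gw.
rewrite -/(u w); apply/eqP; rewrite eq_le; apply/andP; split; apply/ler_addgt0Pr => e e0.
  have [n ne] := @ltr_add_invr R 0 e e0.
  have := h n Gw; rewrite BE // => H; rewrite add0r in ne.
  by apply: ltW; apply: lt_trans H _; rewrite ltrD2l.
have [n ne] := @ltr_add_invr R 0 e e0.
have := l n Gw; rewrite BE // => /negP; rewrite -leNgt => H; rewrite add0r in ne.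
by rewrite -lerBlDr; apply: le_trans H; rewrite lerD2l lerN2 ltW.
Qed.

(** The ratio of [Phi f] to [Phi p] is [cj (Phi p) * Phi f] over the squared modulus of [Phi p]; its
    real and imaginary parts are separately constant on [G]. *)
Lemma ratio_constant f : dual_elt f ->
  exists c : K, {ae mu, forall w, G w -> Phi f w = c * Phi p w}.
Proof.
move=> df; have [mr mi] := mPhi dp; have [fr fi] := mPhi df.
have ma : measurable_fun setT (fun w => abs (Phi p w) ^+ 2).
  by apply: measurable_funX; apply: measurable_abs.
have a0 w : G w -> 0 < abs (Phi p w) ^+ 2 by move=> Gw; rewrite exprn_gt0 // abs_gt0.
have [cr Hr] := support_constant
  (measurable_funD (measurable_funM mr fr) (measurable_funM mi fi)) ma a0.
have [ci Hi] := support_constant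
  (measurable_funB (measurable_funM mr fi) (measurable_funM mi fr)) ma a0.
exists (sc cr + J * sc ci); apply: filterS2 Hr Hi => w Hr Hi Gw.
have {}a0 : abs (Phi p w) ^+ 2 != 0 by rewrite gt_eqF // a0.
set z := sc (abs (Phi p w) ^+ 2)^-1 * (cj (Phi p w) * Phi f w).
have zE : z = sc cr + J * sc ci.
  rewrite [z](@scalarE _ _ _ _ m); congr (sc _ + J * sc _).
    by rewrite /z reZ re_cjM mulrC; exact: Hr.
  by rewrite /z imZ im_cjM mulrC; exact: Hi.
rewrite -zE /z -mulrA [cj _ * _ * _]mulrAC cjM mulrA -rmorphM mulVf // rmorph1 mul1r //.
Qed.

(** [phi f] is the constant ratio on [G]. Then [phi f * p] lives on [G] and the remainder off [G],
    so their norms add up. *)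
Lemma L1_atom_of_data : exists phi, atom p phi.
Proof.
have uniq f c c' : {ae mu, forall w, G w -> Phi f w = c * Phi p w} ->
    {ae mu, forall w, G w -> Phi f w = c' * Phi p w} -> c = c'.
  move=> H H'; apply: contrapT => cc'; apply: support_not_null.
  apply: filterS2 H H' => w H H' Gw; apply: cc'.
  by apply: (mulIf Gw); rewrite -H // H'.
have /choice[phi phiP] : forall f, exists c, dual_elt f ->
    {ae mu, forall w, G w -> Phi f w = c * Phi p w}.
  move=> f; have [/ratio_constant[c Hc]|nf] := pselect (dual_elt f); first by exists c.
  by exists 0.
exists phi; split.
- move=> k f g df dg; apply: (uniq (fun x => k * f x + g x)).
    exact/phiP/(@dual_lin _ _ _ _ m).
  have H : {ae mu, forall w, G w ->
      Phi f w = phi f * Phi p w /\ Phi g w = phi g * Phi p w}.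
    by apply: filterS2 (phiP f df) (phiP g dg) => w Hf Hg Gw; rewrite Hf // Hg.
  by apply: filterS2 H (linPhi k df dg) => w H -> Gw; have [-> ->] := H Gw; ring.
- apply: (uniq p); first exact: phiP.
  by apply: aeW => w _; rewrite mul1r.
move=> f df; set c := phi f.
have dr : dual_elt (fun x => - c * p x + f x) by exact: (@dual_lin _ _ _ _ m).
rewrite (_ : (fun x => f x - c * p x) = fun x => - c * p x + f x); last first.
  by apply/funext => x; rewrite mulNr addrC.
have mr := measurable_abs (mPhi dr); have mp := measurable_abs (mPhi dp).
have mcp : measurable_fun setT (fun w => abs c * abs (Phi p w)) by exact: measurable_funM.
apply: EFin_inj; rewrite EFinD -!int_Phi //.
have -> : (abs c)%:E = (\int[mu]_w (abs c * abs (Phi p w))%:E)%E.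
  under eq_integral do rewrite EFinM.
  rewrite ge0_integralZl_EFin ?abs_ge0 //.
  - by rewrite int_Phi // dual_ext_dualnorm // mule1.
  - by move=> w _; rewrite lee_fin abs_ge0.
  - exact/measurable_EFinP.
rewrite -ge0_integralD //.
- under [in RHS]eq_integral do rewrite -EFinD.
  apply: int_ae_eq.
  + exact: measurable_abs (mPhi df).
  + exact: measurable_funD.
  + apply: filterS2 (linPhi (- c) dp df) (phiP f df) => w -> H.
    have [Gw|/negP] := pselect (G w).
      by rewrite H // mulNr addNr abs0 addr0 absM.
    by rewrite negbK => /eqP ->; rewrite mulr0 abs0 mulr0 !add0r.
- by move=> w _; rewrite lee_fin mulr_ge0 ?abs_ge0.
- exact/measurable_EFinP.
- by move=> w _; rewrite lee_fin abs_ge0.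
- exact/measurable_EFinP.
Qed.

End L1.

Lemma L1_predual_atom p : (exists x : X, x != 0) -> L1_predual (X := X) re im ->
  dual_ext p -> exists phi, atom p phi.
Proof.
move=> X0 [d [Om [mu [Phi [mPhi [linPhi [isoPhi surjPhi]]]]]]] exp.
exact: (@L1_atom_of_data d Om mu Phi).
Qed.

End Atoms.

(** * Functionals on the dual *)

Section AtomCalculus.
Context {R : realType} {K : numFieldType} {re im : K -> R} {m : scalar_model re im}.
Context {X : normedModType K}.
Local Notation sc := (@sc R K re im m).
Local Notation J := (@unitJ R K re im m).
Local Notation abs := (modK re im).
Local Notation nrm := (@nrm R K re X).
Local Notation dualnorm := (@dualnorm R K re im X).
Local Notation atom := (@atom R K re im X).
Implicit Types (f g p q : X -> K) (phi : (X -> K) -> K).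

(** The unit ball of the bidual; the values of [phi] on functions outside the dual are
    unconstrained. *)
Definition bidual_ball phi :=
  (forall (k : K) f g, dual_elt f -> dual_elt g ->
    phi (fun x => k * f x + g x) = k * phi f + phi g) /\
  (forall f, dual_elt f -> abs (phi f) <= dualnorm f).

Lemma atom_bidual p phi : dual_elt p -> atom p phi -> bidual_ball phi.
Proof.
move=> dp [lphi _ Lphi]; split=> // f df; rewrite [leRHS]Lphi // lerDl.
by apply: (@dualnorm_ge0 _ _ _ _ m); apply: (@dual_sub _ _ _ _ m) => //; exact: dual_scale.
Qed.

Lemma bidual_sub phi f g k : bidual_ball phi -> dual_elt f -> dual_elt g ->
  phi (fun x => f x - k * g x) = phi f - k * phi g.
Proof.
move=> [lphi _] df dg.
rewrite (_ : (fun x => f x - k * g x) = fun x => - k * g x + f x).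
  by rewrite lphi //; ring.
by apply/funext => x; ring.
Qed.

Lemma bidual0 phi : bidual_ball phi -> phi (fun=> 0) = 0.
Proof.
move=> [_ /(_ _ (@dual0 _ _ _ _ m X)) H]; apply: (@abs0_eq0 _ _ _ _ m).
apply/eqP; rewrite eq_le abs_ge0 andbT; apply: le_trans H _.
by apply: (@dualnorm_le _ _ _ _ m) => [|x _]; [exact: dual0|rewrite abs0].
Qed.

(** If [c = phi q] is nonzero, then [q] is the sum of [c * p] and a remainder, with norms adding up
    to 1; extremality of [q] makes it a multiple of [p]. *)
Lemma atom_orthogonal p q phi : (exists x : X, x != 0) -> dual_ext p -> dual_ext q ->
  atom p phi -> ~ lin_dep p q -> phi q = 0.
Proof.
move=> X0 exp exq [_ _ Lphi] indep.
have dp := exp.1.1; have dq := exq.1.1; set c := phi q.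
have multE k : q = (fun x => k * p x) -> False.
  move=> qE; apply: indep; exists k, (-1); split; first by right; rewrite oppr_eq0 oner_eq0.
  by move=> x; rewrite qE; ring.
have dr : dual_elt (fun x => q x - c * p x).
  by apply: (@dual_sub _ _ _ _ m) => //; exact: dual_scale.
have := Lphi q dq; rewrite (@dual_ext_dualnorm _ _ _ _ m _ q) // -/c => n1.
apply: (@abs0_eq0 _ _ _ _ m); apply: contrapT => /eqP cn0; set t := abs c in n1 cn0.
have t0 : 0 < t by rewrite lt_neqAle eq_sym cn0 abs_ge0.
have [r0|rn0] := eqVneq (dualnorm (fun x => q x - c * p x)) 0.
  apply: (multE c); apply/funext => x; apply/eqP; rewrite -subr_eq0; apply/eqP.
  exact: (@dualnorm_eq0 _ _ _ _ m _ _ dr r0 x).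
have t1 : t < 1.
  rewrite [ltRHS]n1 ltrDl lt_neqAle eq_sym rn0; exact: (@dualnorm_ge0 _ _ _ _ m).
have sctn : sc t != 0 by rewrite fmorph_eq0.
have sc1tn : 1 - sc t != 0.
  by rewrite -(rmorph1 sc) -rmorphB fmorph_eq0 subr_eq0 eq_sym lt_eqF.
have b1 : dual_ball (fun x => (sc t)^-1 * c * p x).
  apply: (@dualnorm_ball _ _ _ _ m); first exact: dual_scale.
  rewrite dualnormZ // (@dual_ext_dualnorm _ _ _ _ m) // mulr1 absM -fmorphV abs_sc.
  by rewrite gtr0_norm ?invr_gt0 // mulVf.
have b2 : dual_ball (fun x => (1 - sc t)^-1 * (q x - c * p x)).
  apply: (@dualnorm_ball _ _ _ _ m); first exact: dual_scale.
  rewrite dualnormZ // -(rmorph1 sc) -rmorphB -fmorphV abs_sc.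
  rewrite gtr0_norm ?invr_gt0 ?subr_gt0 //.
  have -> : dualnorm (fun x => q x - c * p x) = 1 - t by lra.
  by rewrite mulVf // subr_eq0 eq_sym lt_eqF.
have t01 : 0 < sc t < 1 by rewrite -(rmorph0 sc) -(rmorph1 sc) !sc_lt t0.
have eqq : forall x, (sc t)^-1 * c * p x = (1 - sc t)^-1 * (q x - c * p x).
  apply: (exq.2 _ _ (sc t)) => // x.
  by rewrite -mulrA !mulVKf //; ring.
apply: (multE ((1 - sc t) * ((sc t)^-1 * c) + c)); apply/funext => x.
rewrite mulrDl -mulrA eqq mulVKf //; ring.
Qed.

(** Induction: subtracting the component of [f] along the first extreme point lowers the norm by
    exactly its coefficient and, by orthogonality, leaves the other coefficients unchanged. *)
Lemma atoms_sum n (P : nat -> X -> K) (Ph : nat -> (X -> K) -> K) f :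
  (exists x : X, x != 0) ->
  (forall i, (i < n)%N -> dual_ext (P i) /\ atom (P i) (Ph i)) ->
  (forall i j, (i < j < n)%N -> ~ lin_dep (P j) (P i)) ->
  dual_elt f -> \sum_(i < n) abs (Ph i f) <= dualnorm f.
Proof.
move=> X0; elim: n P Ph f => [|n IHn] P Ph f HP indep df.
  by rewrite big_ord0 (@dualnorm_ge0 _ _ _ _ m).
have [ex0 a0] := HP 0%N isT; have d0 := ex0.1.1.
rewrite big_ord_recl /=; have [_ _ ->//] := a0; rewrite lerD2l.
have dr : dual_elt (fun x => f x - Ph 0%N f * P 0%N x).
  by apply: (@dual_sub _ _ _ _ m) => //; exact: dual_scale.
apply: le_trans (IHn (fun i => P i.+1) (fun i => Ph i.+1) _ _ _ dr).
- apply: ler_sum => i _; rewrite /bump /= add1n.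
  have [exi ai] := HP i.+1 (ltn_ord i).
  have bi := atom_bidual exi.1.1 ai.
  rewrite bidual_sub // (@atom_orthogonal (P i.+1) (P 0%N)) ?mulr0 ?subr0 //.
  by apply: indep; exact: (ltn_ord i).
- by move=> i ilt; exact: HP.
- by move=> i j ij; exact: indep.
Qed.

Lemma bidual_sum phi n (k : nat -> K) (F : nat -> X -> K) : bidual_ball phi ->
  (forall i, dual_elt (F i)) ->
  dual_elt (fun x => \sum_(i < n) k i * F i x) /\
  phi (fun x => \sum_(i < n) k i * F i x) = \sum_(i < n) k i * phi (F i).
Proof.
move=> bphi dF; elim: n => [|n [IHd IHn]].
  rewrite (_ : (fun x => \sum_(i < 0) k i * F i x) = fun=> 0).
    by rewrite big_ord0 bidual0 //; split => //; exact: dual0.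
  by apply/funext => x; rewrite big_ord0.
rewrite (_ : (fun x => \sum_(i < n.+1) k i * F i x) =
    fun x => k n * F n x + \sum_(i < n) k i * F i x); last first.
  by apply/funext => x; rewrite big_ord_recr addrC.
split; first exact: dual_lin.
by rewrite bphi.1 // IHn big_ord_recr addrC.
Qed.

Lemma re_sum n (F : 'I_n -> K) : re (\sum_i F i) = \sum_i re (F i).
Proof. by apply: (big_morph re (@reD _ _ _ _ m)); exact: re0. Qed.

(* Helly: minimise the Euclidean distance from (phi (F i))_i to the image of the ball. *)
Lemma helly phi n (F : nat -> X -> K) e : bidual_ball phi ->
  (forall i, dual_elt (F i)) -> 0 < e ->
  exists2 x, nrm x <= 1 & forall i, (i < n)%N -> abs (F i x - phi (F i)) < e.
Proof.
move=> bphi dF e0.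
pose S x := \sum_(i < n) abs (phi (F i) - F i x) ^+ 2.
pose A := [set S x | x in [set x | nrm x <= 1]].
have S0 x : 0 <= S x by apply: sumr_ge0 => i _; exact: sqr_ge0.
have hA : has_inf A.
  split; first by exists (S 0); exists 0; rewrite //= nrm0 ler01.
  by exists 0 => _ [x _ <-].
have A_le x : nrm x <= 1 -> inf A <= S x.
  by move=> x1; apply: ge_inf; [exact: hA.2|exists x].
pose M := \sum_(i < n) (2 * dualnorm (F i)) ^+ 2.
have M0 : 0 <= M by apply: sumr_ge0 => i _; exact: sqr_ge0.
(* First-order condition at an almost minimiser [x], exact up to [eta ^+ 2]: moving by [eta] towards
   any [y] of the ball gains little, so the functional [g], with coefficients [cj (v i)], almost
   attains its norm at [x]. Since [re (phi g) - re (g x) = S x] and [phi] is in the bidual ball,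
   [S x] is small. *)
have step eta : 0 < eta <= 1 -> inf A <= eta * (1 + M) / 2.
  move=> /andP[eta0 eta1].
  have eta20 : 0 < eta ^+ 2 by exact: exprn_gt0.
  have [_ [x /= x1 <-] Sx] := inf_adherent eta20 hA.
  pose v i := phi (F i) - F i x.
  have [dg phig] := bidual_sum n (fun i => cj (m := m) (v i)) bphi dF.
  set g := (fun y => _) in dg phig.
  have gy y : nrm y <= 1 -> re (g y) <= re (g x) + eta * (1 + M) / 2.
    move=> y1; pose w i := F i y - F i x.
    have W : \sum_(i < n) abs (w i) ^+ 2 <= M.
      apply: ler_sum => i _; rewrite lerXn2r ?nnegrE ?abs_ge0 //.
        by rewrite mulr_ge0 // (@dualnorm_ge0 _ _ _ _ m).
      rewrite /w; apply: le_trans (absB _ _) _; rewrite mulr_natl mulr2n.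
      by apply: lerD; apply: (@dualnorm_sup _ _ _ _ m _ _ (dF i)).1.
    have Bg : re (g y) - re (g x) = \sum_(i < n) (re (v i) * re (w i) + im (v i) * im (w i)).
      rewrite /g !re_sum -sumrB; apply: eq_bigr => i _.
      by rewrite -reB -mulrBr re_cjM.
    pose z := x + sc eta *: (y - x).
    have z1 : nrm z <= 1.
      have -> : z = sc (1 - eta) *: x + sc eta *: y.
        by rewrite /z scalerBr rmorphB rmorph1 scalerBl scale1r addrAC addrA.
      apply: le_trans (nrmD _ _) _; rewrite !nrmZr (gtr0_norm eta0) (@ger0_norm _ (1 - eta)) ?subr_ge0 //.
      nra.
    have Sz : S z = S x - 2 * eta * (re (g y) - re (g x))
        + eta ^+ 2 * \sum_(i < n) abs (w i) ^+ 2.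
      rewrite Bg /S !mulr_sumr -sumrB -big_split /=; apply: eq_bigr => i _.
      have li := (dF i).1.
      rewrite /z lfunD // lfunZ // lfunB // -/(w i) opprD addrA -/(v i).
      by rewrite !abs_sqr !(reB, imB, reZ, imZ); ring.
    have := A_le z z1; rewrite Sz => H.
    have : 2 * eta * (re (g y) - re (g x)) <= eta ^+ 2 * (1 + M).
      have : eta ^+ 2 * \sum_(i < n) abs (w i) ^+ 2 <= eta ^+ 2 * M.
        by rewrite ler_wpM2l // ltW.
      move: Sx H; set s := S x; set s' := \sum_(i < n) _; lra.
    rewrite (_ : 2 * eta * _ = eta * (2 * (re (g y) - re (g x)))); last by ring.
    by rewrite expr2 -mulrA ler_pM2l //; lra.
  have gn : dualnorm g <= re (g x) + eta * (1 + M) / 2.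
    apply: (@dualnorm_le _ _ _ _ m) => // y y1.
    have [a a1 ag] := abs_rotate (m := m) (g y).
    have -> : abs (g y) = re (g (a *: y)) by rewrite (lfunZ _ _ dg.1) ag re_sc.
    by apply: gy; rewrite nrmZ a1 mul1r.
  have : re (phi g) <= re (g x) + eta * (1 + M) / 2.
    by apply: le_trans (re_leabs _) _; apply: le_trans (bphi.2 _ dg) gn.
  have Sxg : re (phi g) - re (g x) = S x.
    rewrite phig /g !re_sum -sumrB; apply: eq_bigr => i _.
    by rewrite -reB -mulrBr re_cjM -/(v i) abs_sqr !expr2.
  have := A_le x x1; rewrite -Sxg; lra.
have A0 : inf A <= 0.
  rewrite leNgt; apply/negP => Ap.
  (* With this choice [step] bounds [inf A] by half of itself. *)
  pose eta := Num.min 1 (inf A / (1 + M)).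
  have M1 : 0 < 1 + M by lra.
  have eta0 : 0 < eta by rewrite lt_min ltr01 divr_gt0.
  have eta1 : eta <= 1 by rewrite ge_min lexx.
  have etaA : eta * (1 + M) <= inf A.
    by rewrite -ler_pdivlMr // ge_min lexx orbT.
  have := step eta; rewrite eta0 eta1 => /(_ isT); lra.
have e20 : 0 < e ^+ 2 by exact: exprn_gt0.
have [_ [x /= x1 <-] Sx] := inf_adherent e20 hA.
exists x => // i ilt.
rewrite -(@ltr_pXn2r _ 2) ?nnegrE ?abs_ge0 ?(ltW e0) //.
apply: (@le_lt_trans _ _ (S x)); last by lra.
rewrite /S (bigD1 (Ordinal ilt)) //= -(@absN _ _ _ _ m) opprB lerDl.
by apply: sumr_ge0 => j _; exact: sqr_ge0.
Qed.

Lemma operator_bound (T : X -> X) : is_operator T ->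
  exists2 M, 0 <= M & forall x, nrm (T x) <= M * nrm x.
Proof.
move=> [_ [C HC]]; exists (abs C); first exact: abs_ge0.
move=> x; rewrite -(@sc_le _ _ _ _ m) rmorphM /= -norm_modK -!normE.
apply: le_trans (HC x) _.
have : 0 <= C * `|x| by exact: le_trans (HC x).
by move=> /ger0_norm <-; rewrite normrM normr_id.
Qed.

Lemma dual_comp (T : X -> X) q : is_operator T -> dual_elt q ->
  dual_elt (fun x => q (T x)).
Proof.
move=> oT dq; have [M M0 HM] := operator_bound oT.
apply: (@dual_intro _ _ _ _ m _ _ (dualnorm q * M)).
  by move=> a x y; rewrite oT.1 dq.1.
move=> x; apply: le_trans (dualnormP (m := m) (T x) dq) _.
by rewrite -mulrA ler_wpM2l ?HM // (@dualnorm_ge0 _ _ _ _ m).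
Qed.

(* The second adjoint of a weakly compact operator takes its values in [X]. *)
Lemma weakly_compact_bidual (T : X -> X) phi : is_operator T -> weakly_compact_op T ->
  bidual_ball phi -> exists z, forall q, dual_elt q -> q z = phi (fun x => q (T x)).
Proof.
move=> oT wT bphi; apply: contrapT => noz.
(* The weakly open sets that a single [q] keeps away from the functional [q |-> phi (q o T)]. If no
   [z] represents it, they cover [X]; Helly's lemma then finds a [T x] with [x] in the ball that
   escapes any finite subfamily. *)
pose F := [set U : set X | weak_open U /\ exists q e, [/\ dual_elt q, 0 < e &
  forall y, U y -> e <= abs (q y - phi (fun x => q (T x)))]].
have [||n [G [FG Gcov]]] := wT F.
- by move=> U [].
- move=> z _.
  have [q [dq qz]] : exists q, dual_elt q /\ q z <> phi (fun x => q (T x)).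
    apply: contrapT => H; apply: noz; exists z => q dq; apply: contrapT => qz.
    by apply: H; exists q.
  pose e := abs (q z - phi (fun x => q (T x))) / 2.
  have e0 : 0 < e by rewrite divr_gt0 // abs_gt0 subr_eq0; exact/eqP.
  exists [set y | abs (q y - q z) < e]; split; last by rewrite /= subrr abs0.
  split.
    move=> y /= yz; exists 1%N, (fun=> q), (sc (e - abs (q y - q z))).
    split; first by rewrite -(rmorph0 sc) sc_lt subr_gt0.
    split=> // y' /(_ 0%N isT); rewrite norm_modK sc_lt => H.
    rewrite (_ : q y' - q z = (q y' - q y) + (q y - q z)); last by ring.
    by apply: le_lt_trans (absD _ _) _; lra.
  exists q, e; split => // y yz.
  have : abs (q z - phi (fun x => q (T x))) <=
      abs (q y - phi (fun x => q (T x))) + abs (q y - q z).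
    rewrite (_ : q z - _ = (q y - phi (fun x => q (T x))) - (q y - q z)); last by ring.
    exact: absB.
  by move: yz; rewrite /= /e; lra.
have /choice[qe qeP] : forall i, exists qe : (X -> K) * R, [/\ dual_elt qe.1, 0 < qe.2 &
    (i < n)%N -> forall y, G i y -> qe.2 <= abs (qe.1 y - phi (fun x => qe.1 (T x)))].
  move=> i; have [ilt|] := ltnP i n; last first.
    by move=> ?; exists ((fun=> 0), 1); split => //; exact: dual0.
  by have [_ [q [e [dq e0 H]]]] := FG i ilt; exists (q, e).
have [e e0 He] : exists2 e, 0 < e & forall i, (i < n)%N -> e <= (qe i).2.
  elim: n {FG Gcov qeP} (fun i => let: And3 _ h _ := qeP i in h) => [|n IHn] H.
    by exists 1.
  have [e e0 He] := IHn H; exists (Num.min e (qe n).2); first by rewrite lt_min e0 H.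
  move=> i; rewrite ltnS leq_eqVlt => /orP[/eqP->|ilt]; first by rewrite ge_min lexx orbT.
  by rewrite ge_min He.
have [x x1 Hx] := @helly phi n (fun i x => (qe i).1 (T x)) e bphi
  (fun i => dual_comp oT (let: And3 h _ _ := qeP i in h)) e0.
have [i [ilt Gi]] : exists i, (i < n)%N /\ G i (T x).
  apply: Gcov => U oU Ux; exists (T x); split => //; exists x => //=.
  by rewrite (@norm_le1 _ _ _ _ m).
have [_ _ /(_ ilt _ Gi) H] := qeP i.
by have := Hx i ilt; rewrite ltNge (le_trans (He i ilt) H).
Qed.

(* Gliding hump: sums of almost disjoint elements of [c0] stay bounded while [q o T2] would
   grow linearly along them. *)
Lemma c0_bidual (T : X -> X) (E : set (nat -> K)) T1 T2 phi q :
  is_operator T -> closed_subspace_c0 E -> (forall x, E (T1 x)) ->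
  (forall (a : K) x y, T1 (a *: x + y) = (fun n => a * T1 x n + T1 y n)) ->
  (exists C : K, forall x n, `|T1 x n| <= C * `|x|) ->
  (exists C : K, forall s (B : K), E s -> (forall n, `|s n| <= B) -> `|T2 s| <= C * B) ->
  (forall x, T x = T2 (T1 x)) -> bidual_ball phi -> dual_elt q ->
  (forall n, dual_elt (fun x => T1 x n)) ->
  (forall n, phi (fun x => T1 x n) = 0) -> phi (fun x => q (T x)) = 0.
Proof.
move=> oT [Ec0 _] ET1 lT1 [C1 HC1] [C2 HC2] TE bphi dq dT1 phi0.
apply: (@abs0_eq0 _ _ _ _ m); apply: contrapT => /eqP an0.
set l := phi _ in an0; set a := abs l in an0.
have a0 : 0 < a by rewrite lt_neqAle eq_sym an0 abs_ge0.
pose c1 := abs C1; pose c2 := abs C2; pose cq := dualnorm q.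
have cq0 : 0 <= cq := @dualnorm_ge0 _ _ _ _ m _ _ dq.
have c20 : 0 <= c2 := abs_ge0 _.
have c10 : 0 <= c1 := abs_ge0 _.
have H1 x n : nrm x <= 1 -> abs (T1 x n) <= c1.
  move=> x1; rewrite -(@sc_le _ _ _ _ m) -!norm_modK.
  apply: le_trans (HC1 x n) _.
  have : 0 <= C1 * `|x| by exact: le_trans (HC1 x n).
  move=> /ger0_norm <-; rewrite normrM normr_id -[leRHS]mulr1 ler_wpM2l //.
  by rewrite (@norm_le1 _ _ _ _ m).
have H2 y B : (forall n, abs (T1 y n) <= B) -> abs (q (T y)) <= cq * (c2 * B).
  move=> HB; have B0 : 0 <= B by exact: le_trans (abs_ge0 _) (HB 0%N).
  apply: le_trans (dualnormP (m := m) _ dq) _; rewrite ler_wpM2l //.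
  rewrite -(@sc_le _ _ _ _ m) -normE TE rmorphM /= -norm_modK.
  have H : `|T2 (T1 y)| <= C2 * sc B.
    by apply: HC2 => // n; rewrite norm_modK sc_le.
  apply: (le_trans H); rewrite -[C2 * sc B]ger0_norm ?normrM; last exact: le_trans H.
  by rewrite (@ger0_norm _ (sc B)) // -(rmorph0 sc) sc_le.
have T1D x y n : T1 (x + y) n = T1 x n + T1 y n.
  by rewrite -[x]scale1r lT1 scale1r mul1r.
pose k := cq * c2; have k0 : 0 <= k by rewrite mulr_ge0.
(* After [N] steps the errors [N * dl] in the sup norm may cost at most [N * a / 4] of the value of
   [q], while [build] guarantees at least [N * a / 2]. The [+ 1] guards against [k = 0]. *)
pose dl := a / (4 * (k + 1)).
have dl0 : 0 < dl by rewrite divr_gt0 // mulr_gt0 //; lra.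
have kdl : k * dl <= a / 4.
  have -> : k * dl = a / 4 * (k / (k + 1)) by rewrite /dl; field; lra.
  by rewrite -[leRHS]mulr1 ler_wpM2l //; [lra|rewrite ler_pdivrMr; lra].
have build N : exists y, (forall n, abs (T1 y n) <= c1 + 1 + N%:R * dl) /\
    abs (q (T y) - N%:R * l) <= N%:R * (a / 2).
  elim: N => [|N [y [y1 y2]]].
    exists 0; split=> [n|].
      rewrite (_ : T1 0 n = 0); first by rewrite abs0 mul0r addr0 addr_ge0.
      by have := lT1 (-1) 0 0; rewrite scaler0 addr0 => /(congr1 (@^~ n)) -> ; ring.
    have T0 : q (T 0) = 0 := lfun0 (dual_comp oT dq).1.
    by rewrite T0 !mul0r subr0 abs0.
  (* Beyond [N0] the old sequence is below 1 and the new one below [c1]; before [N0] the new one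
     adds at most [dl]. Index [N0] of [F] is reserved for [q o T], hence Helly's lemma with [N0.+1]
     functionals. *)
  have [N0 HN0] := Ec0 _ (ET1 y) 1 ltr01.
  pose F i := if (i < N0)%N then (fun x => T1 x i) else (fun x => q (T x)).
  have dF i : dual_elt (F i) by rewrite /F; case: ifP => _ //; exact: dual_comp.
  have ed0 : 0 < Num.min dl (a / 2) by rewrite lt_min dl0 divr_gt0.
  have [x x1 Hx] := @helly phi N0.+1 F _ bphi dF ed0.
  exists (y + x); split.
    move=> n; rewrite T1D; apply: le_trans (absD _ _) _.
    have dlN : 0 <= N%:R * dl by rewrite mulr_ge0 // ltW.
    have [nN|nN] := ltnP n N0.
      have := Hx n (ltnW nN); rewrite /F nN phi0 subr0 lt_min => /andP[Hn _].
      by have := y1 n; rewrite -natr1 mulrDl mul1r; lra.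
    have := HN0 n nN; rewrite norm_modK -(rmorph1 sc) sc_lt => Hn.
    by have := H1 x n x1; rewrite -natr1 mulrDl mul1r; lra.
  have := Hx N0 (leqnn _); rewrite /F ltnn -/l lt_min => /andP[_ Hq].
  rewrite (_ : q (T (y + x)) - _ = (q (T y) - N%:R * l) + (q (T x) - l)); last first.
    by rewrite (lfunD _ _ (dual_comp oT dq).1) -natr1; ring.
  by apply: le_trans (absD _ _) _; rewrite -natr1 mulrDl mul1r; lra.
have bnd N : N%:R * (a / 4) <= k * (c1 + 1).
  have [y [y1 y2]] := build N.
  have := H2 y _ y1; rewrite mulrA -/k => Hq.
  have : N%:R * a <= abs (q (T y)) + N%:R * (a / 2).
    have -> : N%:R * a = abs (sc N%:R * l) by rewrite absM abs_sc ger0_norm.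
    rewrite rmorph_nat (_ : N%:R * l = q (T y) - (q (T y) - N%:R * l)); last by ring.
    by apply: le_trans (absB _ _) _; rewrite lerD2l.
  have : k * (N%:R * dl) <= N%:R * (a / 4) by rewrite mulrCA ler_wpM2l.
  move: Hq; rewrite mulrDr; lra.
have := bnd (Num.bound (k * (c1 + 1) / (a / 4))).
have kk : 0 <= k * (c1 + 1) / (a / 4).
  by rewrite divr_ge0 ?divr_ge0 ?mulr_ge0 ?addr_ge0 // ltW.
have := archi_boundP kk; rewrite ltr_pdivrMr ?divr_gt0 // ltNge => /negP.
exact.
Qed.

End AtomCalculus.

(** * The Daugavet equation *)

Section Daugavet.
Context {R : realType} {K : numFieldType} {re im : K -> R} {m : scalar_model re im}.
Context {X : normedModType K}.
Local Notation sc := (@sc R K re im m).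
Local Notation J := (@unitJ R K re im m).
Local Notation abs := (modK re im).
Local Notation nrm := (@nrm R K re X).
Local Notation dualnorm := (@dualnorm R K re im X).
Local Notation atom := (@atom R K re im X).
Local Notation E := {ptws X -> R}.
Local Notation fn := (@fn R K re im m X).
Local Notation ext := (mix_extreme (@rball R K re im m X)).
Implicit Types (f g p q : X -> K) (phi : (X -> K) -> K) (u v : E) (V W : set E).

Hypothesis X0 : exists x : X, x != 0.
Hypothesis noiso : no_isolated_point_quotient (X := X).
Hypothesis atoms : forall p, dual_ext p -> exists phi, atom p phi.

Definition meets_ext V := exists2 u, ext u & V u.

Lemma dual_ext_rotate p k : abs k = 1 -> dual_ext p -> dual_ext (fun x => k * p x).
Proof.
move=> k1 [bp exp].
have kn0 : k != 0 by rewrite -(@abs_gt0 _ _ _ _ m) k1 ltr01.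
have brot c f : abs c = 1 -> dual_ball f -> dual_ball (fun x => c * f x).
  move=> c1 /(@dual_ballP _ _ _ _ m)[lf fb]; apply/(@dual_ballP _ _ _ _ m); split.
    by move=> a x y; rewrite lf; ring.
  by move=> x; rewrite absM c1 mul1r.
have kV1 : abs k^-1 = 1.
  by rewrite -[LHS]mul1r -k1 -absM mulfV // abs1 k1.
split; first exact: brot.
move=> g h t bg bh t01 H x; apply: (mulfI (invr_neq0 kn0)).
apply: (exp (fun x => k^-1 * g x) (fun x => k^-1 * h x) t) => //; try exact: brot.
by move=> y; rewrite !(mulrCA _ k^-1) -mulrDr -H mulKf.
Qed.

Lemma dual_ext_neq0 p : dual_ext p -> exists x, p x != 0.
Proof.
move=> exp; apply: contrapT => H.
have p0 x : p x = 0 by apply/eqP/negPn/negP => px; apply: H; exists x.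
have := dual_ext_dualnorm (m := m) X0 exp.
have : dualnorm p <= 0.
  by apply: (@dualnorm_le _ _ _ _ m) => [|x _]; [exact: exp.1.1|rewrite p0 abs0].
by move=> /[swap] ->; rewrite ler10.
Qed.

Lemma lin_dep_multiple p q : dual_ext p -> dual_ext q -> lin_dep p q ->
  exists2 k, abs k = 1 & q = fun x => k * p x.
Proof.
move=> exp exq [a [b [ab H]]].
have b0 : b != 0.
  apply/negP => /eqP b0; have [x px] := dual_ext_neq0 exp.
  have := H x; rewrite b0 mul0r addr0 => /eqP; rewrite mulf_eq0 (negbTE px) orbF.
  by case: ab => [/negbTE ->//|]; rewrite b0 eqxx.
have qE : q = fun x => - (a / b) * p x.
  apply/funext => x; apply: (mulfI b0).
  have /eqP := H x; rewrite addrC addr_eq0 => /eqP ->.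
  by rewrite mulrA mulrN mulrCA mulfV // mulr1 mulNr.
exists (- (a / b)) => //.
have := dual_ext_dualnorm (m := m) X0 exq.
rewrite qE (@dualnormZ _ _ _ _ m) ?(dual_ext_dualnorm (m := m) X0 exp) ?mulr1 //.
exact: exp.1.1.
Qed.

(** The value of [u] here is the real part of the 2 by 2 minor of [p] and [fn u] at [x] and [y], so
    on extreme points this is an open description of independence from [p]. *)
Let minor p : set E := [set u | exists x y, u (p x *: y - p y *: x) != 0].

Let minor_open p : open (minor p).
Proof.
rewrite (_ : minor p = \bigcup_(z in [set: X * X])
    [set u : E | u (p z.1 *: z.2 - p z.2 *: z.1) != 0]).
  apply: bigcup_open => z _; apply: (ptws_eval_open _ (D := [set r | r != 0])).
  exact: open_neq.
by apply/seteqP; split=> u => [[x [y H]]|[[x y] _ H]]; [exists (x, y)|exists x, y].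
Qed.

Let minor_dep p u : dual_ext p -> ext u -> minor p u -> ~ lin_dep p (fn u).
Proof.
move=> exp exu [x [y /eqP H]] dep; apply: H.
have [k _ kE] := lin_dep_multiple exp (extreme_dual_ext exu) dep.
have lp := exp.1.1.1.
set z := p x *: y - p y *: x.
have pz : p z = 0 by rewrite /z (lfunB _ _ lp) !(lfunZ _ _ lp) (mulrC (p x)) subrr.
have uz : fn u z = k * p z := congr1 (fun f => f z) kE.
by rewrite -[u z](@re_fn _ _ _ _ m) uz pz mulr0 (@re0 _ _ _ _ m).
Qed.

Let dep_minor p u : dual_ext p -> ext u -> ~ minor p u -> lin_dep p (fn u).
Proof.
move=> exp exu nm; have [x px] := dual_ext_neq0 exp.
have lp := exp.1.1.1; have lu := exu.1.1; have lfu := fn_linear lu.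
have u0 y : u (p x *: y - p y *: x) = 0.
  by apply/eqP/negPn/negP => H; apply: nm; exists x, y.
have fu0 y : fn u (p x *: y - p y *: x) = 0.
  rewrite /fn u0 (_ : - J *: _ = p x *: (- J *: y) - p (- J *: y) *: x).
    by rewrite u0 !rmorph0 mulr0 addr0.
  by rewrite (lfunZ _ _ lp) scalerBr !scalerA (mulrC (- J) (p x)).
exists (- fn u x), (p x); split; first by right.
move=> y; have := fu0 y; rewrite (lfunB _ _ lfu) !(lfunZ _ _ lfu) => <-; ring.
Qed.

(** Otherwise every extreme point in [V] is equivalent to [p]. A unimodular scalar carries any
    member of the class to a given one in [V], so [V] pulls back to a neighbourhood of each member,
    and the class would be isolated. *)
Lemma remove_class p V : dual_ext p -> open V -> meets_ext V ->
  exists W, [/\ open W, W `<=` V, meets_ext W &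
    forall u, ext u -> W u -> ~ lin_dep p (fn u)].
Proof.
move=> exp oV [u0 exu0 Vu0]; exists (V `&` minor p); split.
- exact: openI.
- exact: subIsetl.
- apply: contrapT => nW; apply: (noiso exp); split; first by move=> q [].
  have depV u : ext u -> V u -> lin_dep p (fn u).
    move=> exu Vu; apply: dep_minor => // mu_; apply: nW.
    by exists u.
  move=> q [exq pq].
  have [k1 k11 qE] := lin_dep_multiple exp exq pq.
  have [k2 k21 uE] := lin_dep_multiple exp (extreme_dual_ext exu0) (depV _ exu0 Vu0).
  have k1n : k1 != 0 by rewrite -(@abs_gt0 _ _ _ _ m) k11 ltr01.
  pose k := k2 / k1.
  have kk1 : abs k = 1.
    have := absM (m := m) k k1; rewrite /k divfK // k11 k21 mulr1 => <- //.
  have [s [e [e0 sV]]] := nbhs_basicP (open_nbhs_nbhs (conj oV Vu0)).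
  (* The points and the radius found at [u0] serve at [q] too, because [fn u0] is [k * q] with [k]
     of modulus 1. *)
  exists (size s), (nth 0 s), (sc e); split; first by rewrite -(rmorph0 sc) sc_lt.
  move=> q' exq' near_q; split => //.
  pose h x := k * q' x; have exh : dual_ext h by exact: dual_ext_rotate.
  have Vh : V (fun x => re (h x)).
    apply: sV => y /(nthP 0)[i ilt <-].
    have := near_q i ilt; rewrite norm_modK sc_lt; apply: le_lt_trans.
    rewrite -[u0 _](@re_fn _ _ _ _ m) uE -reB /h.
    apply: le_trans (@re_le_abs R K re im _) _.
    rewrite (_ : _ - _ = k * (q' (nth 0 s i) - q (nth 0 s i))).
      by rewrite absM kk1 mul1r.
    by rewrite qE mulrBr /k mulrA divfK.
  have := depV _ (dual_ext_re exh) Vh; rewrite (@fn_re _ _ _ _ m); last exact: exh.1.1.1.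
  move=> [a [b [ab H]]]; exists a, (b * k); split.
    case: ab => [?|b0]; [by left|right; rewrite mulf_neq0 //].
    by rewrite -(@abs_gt0 _ _ _ _ m) kk1 ltr01.
  by move=> x; rewrite -mulrA; exact: H.
- by move=> u exu [_ mu_]; exact: minor_dep.
Qed.

(** The common engine of both cases, with [h u] the adjoint image of [u] or a fixed functional. Were
    large coefficients available in every open subset, arbitrarily many inequivalent extreme points
    would have coefficients at least [dl] on the same [h v], against [atoms_sum]. *)
Lemma atoms_not_dense (h : E -> X -> K) (dl M : R) V : 0 < dl -> open V -> meets_ext V ->
  (forall u, ext u -> dual_elt (h u) /\ dualnorm (h u) <= M) ->
  ~ (forall W, open W -> W `<=` V -> meets_ext W ->
    exists u phi W', [/\ ext u, atom (fn u) phi, open W', W' `<=` W & W' u /\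
      forall v, ext v -> W' v -> dl <= abs (phi (h v))]).
Proof.
move=> dl0 oV mV hM dense.
have chain N : exists (P : nat -> X -> K) (Ph : nat -> (X -> K) -> K) W, [/\
    [/\ open W, W `<=` V & meets_ext W],
    forall i, (i < N)%N -> dual_ext (P i) /\ atom (P i) (Ph i),
    forall i j, (i < j < N)%N -> ~ lin_dep (P j) (P i) &
    forall v, ext v -> W v -> forall i, (i < N)%N ->
      ~ lin_dep (P i) (fn v) /\ dl <= abs (Ph i (h v))].
  elim: N => [|N [P [Ph [W [[oW WV mW] HP indep HW]]]]].
    exists (fun _ _ => 0), (fun _ _ => 0), V.
    by split; [split|by []|move=> i j; rewrite ltn0 andbF|by []].
  have [u [phi [W' [exu aphi oW' W'W [W'u HW']]]]] := dense W oW WV mW.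
  have exp := extreme_dual_ext exu.
  have [W2 [oW2 W2W' mW2 HW2]] := remove_class exp oW' (ex_intro2 _ _ u exu W'u).
  (* The new point goes to the front; its independence from the older ones comes from the invariant
     on [W], and [remove_class] restores that invariant on [W2]. *)
  exists (fun i => if i is j.+1 then P j else fn u),
    (fun i => if i is j.+1 then Ph j else phi), W2; split.
  - by split => // v /W2W'/W'W/WV.
  - by case=> [|i] //= ilt; exact: HP.
  - move=> [|i] [|j] //; rewrite ?ltnS => ij; last exact: indep.
    exact: (HW u exu (W'W _ W'u) j ij).1.
  - move=> v exv W2v [|i] ilt; first by split; [exact: HW2|exact/HW'/W2W'].
    exact: HW (W'W _ (W2W' _ W2v)) _ ilt.
have bnd N : N%:R * dl <= M.
  have [P [Ph [W [[oW WV [v exv Wv]] HP indep HW]]]] := chain N.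
  have [dh hv] := hM v exv.
  apply: le_trans hv; apply: le_trans (atoms_sum X0 HP indep dh).
  rewrite mulr_natl -[N in leLHS]card_ord -sumr_const.
  by apply: ler_sum => i _; exact: (HW v exv Wv i (ltn_ord i)).2.
have M0 : 0 <= M by have := bnd 0%N; rewrite mul0r.
have := archi_boundP (divr_ge0 M0 (ltW dl0)); rewrite ltr_pdivrMr // ltNge.
by move/negP; apply; exact: bnd.
Qed.

Variable T : X -> X.
Hypothesis oT : is_operator T.
Variable c : R.
Hypothesis cT : ball_sup (re := re) (fun x => nrm (T x)) c.

Lemma dualnorm_adjoint p : dual_ball p -> dualnorm (fun x => p (T x)) <= c.
Proof.
move=> /[dup] [[dp _]] /(@dual_ballP _ _ _ _ m)[_ pb].
apply: (@dualnorm_le _ _ _ _ m); first exact: (@dual_comp _ _ _ _ m).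
by move=> x x1; apply: le_trans (pb _) _; exact: cT.1.
Qed.

(** The open convex set of functionals below [nrm y] at [y] omits a norming functional, hence also
    an extreme point, which therefore attains the norm at [y]. *)
Lemma slice_meets_ext (y : X) (r : R) : r < nrm y -> meets_ext [set u | r < u y].
Proof.
move=> ry; have [u [lu un uy]] := @norming_functional _ _ _ _ m X y.
have [|||e exe ne] := @open_convex_misses_extreme R X (@rball R K re im m X)
  (@rball_compact _ _ _ _ m X) (@rball_convex _ _ _ _ m X) [set v | v y < nrm y].
- by apply: (@ptws_eval_open R X _ [set s | s < nrm y]); exact: open_lt.
- move=> f g t [Cf Hf] [Cg Hg] /[dup] t01 /andP[t0 t1]; split; first exact: rball_convex.
  move: Hf Hg; rewrite /= /mix => Hf Hg.
  have [->|tn0] := eqVneq t 0; first by rewrite mul0r add0r subr0 mul1r.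
  have tp : 0 < t by rewrite lt_neqAle eq_sym tn0.
  have := Hf; rewrite -(ltr_pM2l tp) => H1.
  have : (1 - t) * g y <= (1 - t) * nrm y by apply: ler_wpM2l; [lra|exact: ltW].
  by lra.
- by exists u => //=; rewrite uy ltxx.
- by exists e => //=; move/negP: ne; rewrite -leNgt; exact: lt_le_trans.
Qed.

Lemma daugavet_of_small_coefficient :
  (forall V e, 0 < e -> open V -> meets_ext V -> exists u phi,
    [/\ ext u, V u, atom (fn u) phi & abs (phi (fun x => fn u (T x))) <= e]) ->
  ball_sup (re := re) (fun x => nrm (x + T x)) (1 + c).
Proof.
move=> small; split=> [x x1|d Hd].
  by apply: le_trans (nrmD _ _) _; apply: lerD => //; exact: cT.1.
apply/ler_addgt0Pr => e e0.
(* One third is lost in the slice and two in [|l|], which enters both through [|1 + l| >= 1 - |l|]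
   and through the remainder of the adjoint image. *)
have e30 : 0 < e / 3 by rewrite divr_gt0.
have [x x1 Hx] : exists2 x, nrm x <= 1 & c - e / 3 < nrm (T x).
  apply: contrapT => H; have : c <= c - e / 3; last by lra.
  apply: cT.2 => x x1; rewrite leNgt; apply/negP => Hx; apply: H.
  by exists x.
have oV : open [set u : E | c - e / 3 < u (T x)].
  by apply: (@ptws_eval_open R X _ [set s | c - e / 3 < s]); exact: open_gt.
have [u [phi [exu Vu aphi phie]]] := small _ _ e30 oV (slice_meets_ext Hx).
set p := fn u in aphi phie; have exp : dual_ext p := extreme_dual_ext exu.
have dp := exp.1.1; have dpT := dual_comp (m := m) oT dp.
have [lphi phip Lphi] := aphi.
set l := phi (fun x => p (T x)) in phie.
have dpp := dual_lin (m := m) 1 dp dpT.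
have phi1 : phi (fun x => 1 * p x + p (T x)) = 1 + l by rewrite lphi // phip mul1r.
have N1 := Lphi _ dpp; rewrite phi1 in N1.
have N2 := Lphi _ dpT; rewrite -/l in N2.
have rE : (fun x => 1 * p x + p (T x) - (1 + l) * p x) = fun x => p (T x) - l * p x.
  by apply/funext => y; ring.
rewrite rE in N1.
have Nd : dualnorm (fun x => 1 * p x + p (T x)) <= d.
  apply: (@dualnorm_le _ _ _ _ m) => // y y1.
  rewrite mul1r -(lfunD _ _ dp.1); have /(@dual_ballP _ _ _ _ m)[_ pb] := exp.1.
  by apply: le_trans (pb _) _; exact: Hd.
have NT : c - e / 3 <= dualnorm (fun x => p (T x)).
  apply: le_trans ((dualnorm_sup (m := m) dpT).1 x x1).
  apply: le_trans (re_leabs _); rewrite re_fn; exact: ltW.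
have l1 : 1 <= abs (1 + l) + abs l.
  by have := absB (m := m) (1 + l) l; rewrite addrK abs1.
lra.
Qed.

Lemma small_coefficient_weakly_compact V e : weakly_compact_op T ->
  0 < e -> open V -> meets_ext V -> exists u phi,
    [/\ ext u, V u, atom (fn u) phi & abs (phi (fun x => fn u (T x))) <= e].
Proof.
move=> wT e0 oV mV; apply: contrapT => nsmall.
have e20 : 0 < e / 2 by rewrite divr_gt0.
apply: (@atoms_not_dense (fun u x => fn u (T x)) (e / 2) c V e20 oV mV).
  move=> u exu; have bu := (extreme_dual_ext exu).1.
  by split; [exact: (@dual_comp _ _ _ _ m) oT bu.1|exact: dualnorm_adjoint].
move=> W oW WV [u exu Wu].
have exp := extreme_dual_ext exu; have [phi aphi] := atoms exp.
have bphi := atom_bidual (m := m) exp.1.1 aphi.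
have [z Hz] := weakly_compact_bidual oT wT bphi.
(* The points where [fn v z] has modulus above [e / 2]: since [v] records only the real part, the
   modulus is reached by rotating [z]. Openness of [D] is where the representation of [phi] by a
   vector [z] is used. *)
pose D := \bigcup_(k in [set k | abs k = 1]) [set v : E | e / 2 < v (k *: z)].
exists u, phi, (W `&` D); split => //.
- apply: openI => //; apply: bigcup_open => k _.
  by apply: (@ptws_eval_open R X _ [set s | e / 2 < s]); exact: open_gt.
- split.
    split => //; have [k k1 kz] := abs_rotate (m := m) (fn u z).
    exists k => //=; rewrite -[u _](@re_fn _ _ _ _ m) (lfunZ _ _ exp.1.1.1) kz re_sc.
    rewrite Hz; last exact: exp.1.1.
    rewrite ltNge; apply/negP => H; apply: nsmall; exists u, phi; split => //.
      exact: WV.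
    by lra.
  move=> v exv [_ [k k1 /= /ltW kz]]; have exq := extreme_dual_ext exv.
  rewrite -Hz; last exact: exq.1.1.
  have -> : abs (fn v z) = abs (fn v (k *: z)).
    by rewrite (lfunZ _ _ exq.1.1.1) absM k1 mul1r.
  by apply: le_trans (re_leabs _); rewrite re_fn.
Qed.

Lemma small_coefficient_c0 V e : factors_through_c0_subspace T ->
  0 < e -> open V -> meets_ext V -> exists u phi,
    [/\ ext u, V u, atom (fn u) phi & abs (phi (fun x => fn u (T x))) <= e].
Proof.
move=> [E0 [T1 [T2 [cE [ET1 [lT1 [[C1 bT1] [_ [bT2 TE]]]]]]]]] e0 oV mV.
have dT1 n : dual_elt (fun x => T1 x n).
  split; first by move=> a x y; rewrite lT1.
  by exists C1 => x; exact: bT1.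
(* The pairs [(n, k)] are coded by naturals to fit [extreme_baire]; [Z j] is empty when [j] codes no
   pair. *)
pose Z (j : nat) := [set u : E | exists phi n k, [/\ atom (fn u) phi,
  unpickle j = Some (n, k) & k.+1%:R^-1 <= abs (phi (fun x => T1 x n))]].
have ndZ j W : open W -> meets_ext W -> exists W', [/\ open W', W' `<=` W,
    meets_ext W' & forall u, ext u -> W' u -> ~ Z j u].
  move=> oW mW; apply: contrapT => H.
  have [[[n k] jE]|jn] := pselect (exists nk : nat * nat, unpickle j = Some nk); last first.
    apply: H; exists W; split => // u _ _ [phi [n [k [_ jE _]]]].
    by apply: jn; exists (n, k).
  have k0 : 0 < k.+1%:R^-1 :> R by rewrite invr_gt0 ltr0n.
  apply: (@atoms_not_dense (fun _ x => T1 x n) k.+1%:R^-1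
    (dualnorm (fun x => T1 x n)) W k0 oW mW) => //.
  move=> W' oW' W'W mW'.
  have [u [exu W'u Zu]] : exists u, [/\ ext u, W' u & Z j u].
    apply: contrapT => H'; apply: H; exists W'; split => // u exu W'u Zu.
    by apply: H'; exists u.
  have [phi [n' [k' [aphi]]]] := Zu; rewrite jE => -[<- <-] kphi.
  (* The functional is the same at every [v], so the coefficient bound at [u] holds on all of [W']
     without shrinking it. *)
  by exists u, phi, W'; split => //; split.
have [u [exu Vu nZ]] := extreme_baire (@rball_compact _ _ _ _ m X)
  (@rball_convex _ _ _ _ m X) ndZ oV mV.
have exp := extreme_dual_ext exu; have [phi aphi] := atoms exp.
have bphi := atom_bidual (m := m) exp.1.1 aphi.
exists u, phi; split => //.
rewrite (@c0_bidual _ _ _ _ m _ T E0 T1 T2) ?abs0 ?ltW //.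
- by exists C1.
- exact: exp.1.1.
- move=> n; apply: (@abs0_eq0 _ _ _ _ m); apply/eqP; rewrite eq_le abs_ge0 andbT leNgt.
  apply/negP => a0; have [k] := @ltr_add_invr R 0 _ a0; rewrite add0r => ka.
  apply: (nZ (pickle (n, k))); exists phi, n, k; split => //; last exact: ltW.
  by rewrite pickleK.
Qed.

End Daugavet.

Lemma daugavet_scalars (R : realType) (K : numFieldType) (re im : K -> R)
    (m : scalar_model re im) (X : normedModType K) :
  (exists x : X, x != 0) -> L1_predual (X := X) re im ->
  no_isolated_point_quotient (X := X) ->
  forall T : X -> X, is_operator T ->
    (weakly_compact_op T \/ factors_through_c0_subspace T) ->
    forall c : K, is_norm_sup (fun x => `|T x|) c ->
      is_norm_sup (fun x => `|x + T x|) (1 + c).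
Proof.
move=> X0 L1 noiso T oT wT c cT.
have atoms p := @L1_predual_atom _ _ _ _ m X p X0 L1.
have [cE {}cT] := norm_sup_ball (m := m) (fun x => normE (m := m) (T x))
  (fun x => nrm_ge0 (m := m) (T x)) cT.
rewrite cE -(rmorph1 (@sc R K re im m)) -rmorphD /=.
apply: (@ball_norm_sup _ _ _ _ m _ _ (fun x => nrm (re := re) (x + T x))).
- by move=> x; exact: normE.
- by move=> x; exact: (@nrm_ge0 _ _ _ _ m).
apply: daugavet_of_small_coefficient => // V e e0 oV mV.
case: wT => wT; first exact: (small_coefficient_weakly_compact X0 noiso atoms oT cT).
exact: (small_coefficient_c0 X0 noiso atoms oT).
Qed.

Lemma real_scalar_model (R : realType) : scalar_model (fun z : R => z) (fun _ : R => 0 : R).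
Proof.
apply: (@ScalarModel R R _ _ (GRing.RMorphism.clone _ _ (@idfun R) _) 0) => //=.
- by left.
- by move=> z; rewrite mul0r addr0.
- by move=> z; rewrite oppr0 mul0r.
- by move=> z; rewrite /modK expr0n addr0 sqrtr_sqr.
Qed.

Lemma complex_scalar_model (R : realType) : scalar_model (@complex.Re R) (@complex.Im R).
Proof.
apply: (@ScalarModel R R[i] _ _
  (GRing.RMorphism.clone _ _ (real_complex R) _) 'i%C) => //=.
- by right; rewrite -expr2 sqr_i.
- exact: lecR.
- exact: complexE.
- by move=> [a b] [c d].
- by move=> a [b c] /=; rewrite mul0r subr0.
- by move=> [a b] /=; rewrite oppr0 mul0r mulN1r opprK add0r.
- exact: normc_def.
- by move=> [a b]; rewrite lecE /= => /andP[/eqP -> _].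
Qed.

Theorem theorem3p5 :
  (* real case *)
  (forall (R : realType) (X : completeNormedModType R),
     (exists x : X, x != 0) ->
     L1_predual (X := X) (fun z : R => z) (fun _ => 0) ->
     no_isolated_point_quotient (X := X) ->
     forall T : X -> X, is_operator T ->
       (weakly_compact_op T \/ factors_through_c0_subspace T) ->
       forall c : R, is_norm_sup (fun x => `|T x|) c ->
         is_norm_sup (fun x => `|x + T x|) (1 + c)) /\
  (* complex case *)
  (forall (R : realType) (X : completeNormedModType R[i]),
     (exists x : X, x != 0) ->
     L1_predual (X := X) (@complex.Re R) (@complex.Im R) ->
     no_isolated_point_quotient (X := X) ->
     forall T : X -> X, is_operator T ->
       (weakly_compact_op T \/ factors_through_c0_subspace T) ->
       forall c : R[i], is_norm_sup (fun x => `|T x|) c ->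
         is_norm_sup (fun x => `|x + T x|) (1 + c)).
Proof.
split=> R X.
- exact: (@daugavet_scalars R R _ _ (real_scalar_model R) X).
- exact: (@daugavet_scalars R R[i] _ _ (complex_scalar_model R) X).
Qed.
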